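(* Let $p\in\{1,2\}$, $d\in\{1,2\}$, $T>0$, and let $\Omega=(0,a)$ with $a>0$ if $d=1$, or $\Omega=(0,a_1)\times(0,a_2)$ with $a_1,a_2>0$ if $d=2$. There is an integer $m$ such that the following holds (''sufficiently smooth'' means of class $C^m$ up to the boundary). Let $u:\overline\Omega\times[0,T]\to\mathbb{R}^d$ be sufficiently smooth with $u=0$ on $\partial\Omega\times[0,T]$, let $\zeta:\overline\Omega\times[0,T]\to\mathbb{R}^{d\times d}$ be sufficiently smooth, and let $h_0,\gamma_1,\gamma_2>0$ be constants. Then there is a constant $C>0$, independent of $\Delta t$, of the mesh, of $x$ and of $n$, such that for every $\Delta t>0$ with $\Delta t\,|u|_{C^0([0,T];W^{1,\infty}(\Omega)^d)}\le 1/8$, every uniform rectangular mesh of $\overline\Omega$ (as described in the context) with $h\in(0,h_0]$ and $\gamma_1\le h/h_{\min}\le\gamma_2$, every lattice point $x\in\overline\Omega_h$, and every $n\in\{2,\ldots,N_T\}$, $$\Bigl|\overset{\nabla}{\zeta}(x,t^n)-[\mathcal{A}_h^{n,(p)}\zeta](x)\Bigr|\le C\,(\Delta t^2+h^p),$$ where $$[\mathcal{A}_h^{n,(p)}\zeta](x)=\frac{1}{2\Delta t}\Bigl[3\zeta^n(x)-4L_1^n(x)\,\bigl(\Pi_h^{(p)}\zeta^{n-1}\bigr)\bigl(X_1^n(x)\bigr)\,L_1^n(x)^\top+\tilde L_1^n(x)\,\bigl(\Pi_h^{(p)}\zeta^{n-2}\bigr)\bigl(\tilde X_1^n(x)\bigr)\,\tilde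 L_1^n(x)^\top\Bigr].$$
   Context: Notation: $t^n=n\Delta t$, $N_T=\lfloor T/\Delta t\rfloor$, and $f^n=f(\cdot,t^n)$. $(\nabla u)_{ij}=\partial u_i/\partial x_j$; $|\cdot|$ is the Euclidean norm (Frobenius norm for matrices); $|u|_{C^0([0,T];W^{1,\infty}(\Omega)^d)}=\max_{t\in[0,T]}\operatorname{ess\,sup}_{x\in\Omega}|\nabla u(x,t)|$. The upper-convected time derivative is $$\overset{\nabla}{\zeta}=\frac{\partial\zeta}{\partial t}+(u\cdot\nabla)\zeta-(\nabla u)\zeta-\zeta(\nabla u)^\top .$$ Further, $X_1^n(x)=x-\Delta t\,u^n(x)$, $\tilde X_1^n(x)=x-2\Delta t\,u^n(x)$, $L_1^n(x)=I+\Delta t(\nabla u^n)(x)$, $\tilde L_1^n(x)=I+2\Delta t(\nabla u^n)(x)$. The conditions on $u$ and $\Delta t$ ensure $X_1^n(x),\tilde X_1^n(x)\in\overline\Omega$ for $x\in\overline\Omega$. A function is of class $C^m$ up to the boundary if all its partial derivatives of order at most $m$ extend continuously to $\overline\Omega\times[0,T]$. Mesh. For $d=1$: $N\in\mathbb{N}$, $h=h_{\min}=a/N$, lattice points $x_i=ih$, $\overline\Omega_h=\{x_i: i=0,\ldots,N\}$. For $d=2$: $N_1,N_2\in\mathbb{N}$, $h_k=a_k/N_k$ $(k=1,2)$, $h=\max\{h_1,h_2\}$, $h_{\min}=\min\{h_1,h_2\}$, lattice points $x_{i,j}=(ih_1,jh_2)^\top$, $\overline\Omega_h=\{x_{i,j}: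 i=0,\ldots,N_1,\ j=0,\ldots,N_2\}$. When $p=2$, $N$ (resp. $N_1$ and $N_2$) is assumed even. One-dimensional basis functions. For $i\in\mathbb{Z}$, $\delta>0$, $s\in\mathbb{R}$: $\eta_i^{(1)}(s;\delta)=\frac{s}{\delta}-i+1$ for $s\in[(i-1)\delta,i\delta)$, $=i+1-\frac{s}{\delta}$ for $s\in[i\delta,(i+1)\delta]$, and $0$ otherwise. For $i$ even, $\eta_i^{(2)}(s;\delta)=\bigl(\frac{s}{\delta}-i+1\bigr)\bigl(\frac{s}{2\delta}-\frac{i}{2}+1\bigr)$ for $s\in[(i-2)\delta,i\delta)$, $=\bigl(i+1-\frac{s}{\delta}\bigr)\bigl(\frac{i}{2}+1-\frac{s}{2\delta}\bigr)$ for $s\in[i\delta,(i+2)\delta]$, and $0$ otherwise. For $i$ odd, $\eta_i^{(2)}(s;\delta)=\bigl(\frac{s}{\delta}-i+1\bigr)\bigl(i+1-\frac{s}{\delta}\bigr)$ for $s\in[(i-1)\delta,(i+1)\delta]$, and $0$ otherwise. Interpolation operators ((bi)linear for $p=1$, (bi)quadratic for $p=2$). For a matrix-valued function $v$ whose values at the lattice points are given (a function on $\overline\Omega$ is identified with its restriction to $\overline\Omega_h$), and $y\in\overline\Omega$: if $d=1$, $(\Pi_h^{(p)}v)(y)=\sum_{i=0}^N v(x_i)\,\eta_i^{(p)}(y;h)$; if $d=2$, $(\Pi_h^{(p)}v)(y)=\sum_{i=0}^{N_1}\sum_{j=0}^{N_2} v(x_{i,j})\,\eta_i^{(p)}(y_1;h_1)\,\eta_j^{(p)}(y_2;h_2)$.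 *)

(* Defs.v *)
From HB Require Import structures.
From mathcomp Require Import all_boot all_order all_algebra.
From mathcomp Require Import all_classical all_reals all_analysis.
From mathcomp Require Import ess_sup_inf.

Set Implicit Arguments.
Unset Strict Implicit.
Unset Printing Implicit Defensive.

Import Order.TTheory GRing.Theory Num.Theory.
Import numFieldNormedType.Exports.

Local Open Scope classical_set_scope.
Local Open Scope ring_scope.

(* Points of R^d are row vectors; a space-time function is a total function of
   (x, t) : 'rV[R]_d * R of which only the values on the closed cylinder
   closure Omega * [0, T] matter. *)

Section Domain.
Context {R : realType} {d : nat}.
Implicit Types (a : 'I_d -> R) (T : R).

Definition Omega a : set 'rV[R]_d := [set x | forall k, 0 < x 0 k < a k].

Definition cyl a T : set ('rV[R]_d * R) := Omega a `*` `]0, T[%classic.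

Definition ccyl a T : set ('rV[R]_d * R) := closure (Omega a) `*` `[0, T]%classic.

(* [Some k] is the direction of x_k and [None] the direction of t. *)
Definition dir (k : option 'I_d) : 'rV[R]_d * R :=
  if k is Some j then (delta_mx 0 j, 0) else (0, 1).

Definition partials (s : seq (option 'I_d)) (f : 'rV[R]_d * R -> R) :
    'rV[R]_d * R -> R :=
  foldr (fun k g => fun z => 'D_(dir k) g z) f s.

(* Class C^m up to the boundary.  At order 0 the continuous extension is
   required to be [f] itself, whence the first conjunct. *)
Definition smooth_fun a T (m : nat) (f : 'rV[R]_d * R -> R) : Prop :=
  {within ccyl a T, continuous f} /\
  forall s : seq (option 'I_d), (size s <= m)%N ->
    (forall k z, (size s < m)%N -> cyl a T z ->
       derivable (partials s f) z (dir k)) /\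
    (exists g : 'rV[R]_d * R -> R,
       {within ccyl a T, continuous g} /\
       forall z, cyl a T z -> g z = partials s f z).

Definition smooth a T (m : nat) r c (f : 'rV[R]_d * R -> 'M[R]_(r, c)) : Prop :=
  forall i j, smooth_fun a T m (fun z => f z i j).

(* First-order partial derivative on the closed cylinder: the limit of the
   partial derivative taken from the open cylinder, i.e. its continuous
   extension (at points of the open cylinder, the derivative itself when the
   function is C^1). *)
Definition pderiv a T r c (k : option 'I_d)
    (f : 'rV[R]_d * R -> 'M[R]_(r, c)) (z : 'rV[R]_d * R) : 'M[R]_(r, c) :=
  \matrix_(i, j) lim ('D_(dir k) (fun w => f w i j : R) w
                        @[w --> within (cyl a T) (nbhs z)]).

Definition grad a T (u : 'rV[R]_d * R -> 'rV[R]_d) (z : 'rV[R]_d * R) : 'M[R]_d :=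
  \matrix_(i, j) pderiv a T (Some j) u z 0 i.

Definition upper_convected a T (u : 'rV[R]_d * R -> 'rV[R]_d)
    (zeta : 'rV[R]_d * R -> 'M[R]_d) (z : 'rV[R]_d * R) : 'M[R]_d :=
  pderiv a T None zeta z
  + \sum_k u z 0 k *: pderiv a T (Some k) zeta z
  - grad a T u z *m zeta z
  - zeta z *m (grad a T u z)^T.

(* Euclidean norm; the library norm on matrices is the maximum norm. *)
Definition enorm r c (A : 'M[R]_(r, c)) : R :=
  Num.sqrt (\sum_i \sum_j A i j ^+ 2).

(* Essential supremum over Omega of a nonnegative function, w.r.t. the Lebesgue
   measure of R^d, for d = 1 (first branch) and d = 2 (second branch; this
   branch is meaningless for other d).  Extending the function by 0 outside
   Omega does not change the value, as Omega has positive measure. *)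
Definition ess_sup_Omega a (f : 'rV[R]_d -> R) : \bar R :=
  let mu := @lebesgue_measure R in
  if d == 1%N then
    ess_sup mu (fun s : R => ((f \_ (Omega a)) (\row_(k < d) s))%:E)
  else
    ess_sup (mu \x mu)%E
      (fun s : R * R =>
         ((f \_ (Omega a)) (\row_(k < d) if k == 0%N :> nat then s.1 else s.2))%:E).

Definition C0W1inf a T (u : 'rV[R]_d * R -> 'rV[R]_d) : \bar R :=
  ereal_sup [set ess_sup_Omega a (fun x => enorm (grad a T u (x, t)))
            | t in `[0, T]%classic].

End Domain.

Section Mesh.
Context {R : realType} {d : nat}.
Implicit Types (a : 'I_d -> R) (N : 'I_d -> nat).

Definition mesh_size a N (k : 'I_d) : R := a k / (N k)%:R.

Definition hmax a N : R := \big[Num.max/0]_(k < d) mesh_size a N k.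

(* The index element [hmax a N] is neutral, being an upper bound. *)
Definition hmin a N : R := \big[Num.min/hmax a N]_(k < d) mesh_size a N k.

Definition mesh_idx N := {dffun forall k : 'I_d, 'I_(N k).+1}.

Definition lattice_pt a N (i : mesh_idx N) : 'rV[R]_d :=
  \row_k ((i k)%:R * mesh_size a N k).

Definition Omega_h a N : set 'rV[R]_d := range (lattice_pt a (N := N)).

Definition eta1 (i : int) (s delta : R) : R :=
  if (i - 1)%:~R * delta <= s < i%:~R * delta then s / delta - i%:~R + 1
  else if i%:~R * delta <= s <= (i + 1)%:~R * delta then i%:~R + 1 - s / delta
  else 0.

Definition eta2 (i : int) (s delta : R) : R :=
  if odd `|i|%N then
    if (i - 1)%:~R * delta <= s <= (i + 1)%:~R * delta then
      (s / delta - i%:~R + 1) * (i%:~R + 1 - s / delta)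
    else 0
  else
    if (i - 2)%:~R * delta <= s < i%:~R * delta then
      (s / delta - i%:~R + 1) * (s / (2 * delta) - i%:~R / 2 + 1)
    else if i%:~R * delta <= s <= (i + 2)%:~R * delta then
      (i%:~R + 1 - s / delta) * (i%:~R / 2 + 1 - s / (2 * delta))
    else 0.

(* Used for p = 1 and p = 2 only. *)
Definition etap (p : nat) : int -> R -> R -> R := if p == 1%N then eta1 else eta2.

Definition interp (p : nat) a N r c (v : 'rV[R]_d -> 'M[R]_(r, c))
    (y : 'rV[R]_d) : 'M[R]_(r, c) :=
  \sum_(i : mesh_idx N)
    (\prod_(k < d) etap p (i k)%:Z (y 0 k) (mesh_size a N k))
      *: v (lattice_pt a i).

End Mesh.

Section Scheme.
Context {R : realType} {d : nat}.
Variables (a : 'I_d -> R) (T dt : R) (u : 'rV[R]_d * R -> 'rV[R]_d).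

Definition tn (n : nat) : R := n%:R * dt.

Definition X1 n x := x - dt *: u (x, tn n).
Definition tX1 n x := x - (2 * dt) *: u (x, tn n).
Definition L1 n x : 'M[R]_d := 1%:M + dt *: grad a T u (x, tn n).
Definition tL1 n x : 'M[R]_d := 1%:M + (2 * dt) *: grad a T u (x, tn n).

Definition Ah (p : nat) (N : 'I_d -> nat) (n : nat)
    (zeta : 'rV[R]_d * R -> 'M[R]_d) (x : 'rV[R]_d) : 'M[R]_d :=
  (2 * dt)^-1 *:
    (3 *: zeta (x, tn n)
     - 4 *: (L1 n x
             *m interp p a N (fun y => zeta (y, tn (n - 1))) (X1 n x)
             *m (L1 n x)^T)
     + tL1 n x
         *m interp p a N (fun y => zeta (y, tn (n - 2))) (tX1 n x)
         *m (tL1 n x)^T).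

End Scheme.

(* Main.v *)
(* Put g = grad u(x, t^n) and
     phi(s) = (I + s g) zeta(x - s u(x, t^n), t^n - s) (I + s g)^T.
   Then -phi'(0) is the upper-convected derivative, and the scheme without
   interpolation is the backward difference
   (3 phi(0) - 4 phi(dt) + phi(2 dt)) / (2 dt), which is exact on quadratic
   polynomials; a third-order Taylor expansion of zeta leaves O(dt^2).

   The interpolation error gets divided by dt, so O(h^p) requires an
   interpolation error O(h^p dt).  It holds because this error vanishes at the
   lattice point x: in one variable, expanding at s and using that the basis
   reproduces polynomials of degree p, the error at s is bounded by
   sum_m |eta_m(s)| |s - m delta|^(p+1), and
   |eta_m(s)| |s - m delta| <= 2 |s - l delta| for every node l.  Several
   variables are treated one coordinate at a time, and |X_1^n(x) - x| = O(dt).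

   Let M bound grad u.  If 2 dt M <= 1, the upwind points stay in the closed
   domain because u vanishes on the boundary.  If 2 dt M > 1, all terms are
   bounded, the interpolant even on all of R^d, so the Taylor remainder is
   trivially O(dt^3). *)

Require Import Defs.
From HB Require Import structures.
From mathcomp Require Import all_boot all_order all_algebra.
From mathcomp Require Import all_classical all_reals all_analysis.
From mathcomp Require Import ring lra zify.

Set Implicit Arguments.
Unset Strict Implicit.
Unset Printing Implicit Defensive.

Import Order.TTheory GRing.Theory Num.Theory.
Import numFieldNormedType.Exports.

Local Open Scope classical_set_scope.
Local Open Scope ring_scope.

(** * Taylor inequalities on an interval *)

Section Taylor1D.
Context {R : realType}.
Implicit Types (x y M K : R) (f df : R -> R).

(** The endpoints come in either order because the displacements to be treated have either sign. *)
Let between x y := [set r : R | Num.min x y <= r <= Num.max x y].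

Lemma betweenl x y : between x y x.
Proof. by rewrite /between /= ge_min lexx le_max lexx. Qed.

Lemma betweenr x y : between x y y.
Proof. by rewrite /between /= ge_min le_max !lexx !orbT. Qed.

Lemma between_trans x y r s : between x y r -> between x r s -> between x y s.
Proof.
rewrite /between /= !ge_min !le_max.
by move=> /andP[/orP[] ? /orP[] ?] /andP[/orP[] ? /orP[] ?];
  apply/andP; split; apply/orP; (try by left; lra); (try by right; lra); lra.
Qed.

Lemma between_dist x y r : between x y r -> `|r - x| <= `|y - x|.
Proof.
rewrite /between /= !ge_min !le_max => /andP[/orP[] ? /orP[] ?];
 by rewrite ler_norml; case: (ger0P (y - x)) => ?; lra.
Qed.

Lemma MVT_between f df x y :
  (forall r, between x y r -> is_derive r 1 f (df r)) ->
  exists2 c, between x y c & f y - f x = df c * (y - x).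
Proof.
wlog: x y / x <= y => [H fd|].
  have [/H|/ltW yx] := leP x y; first exact.
  have [|c cP E] := H y x yx.
    by move=> r rP; apply: fd; move: rP; rewrite /between /= minC maxC.
  by exists c; [move: cP; rewrite /between /= minC maxC | lra].
rewrite le_eqVlt => /predU1P[->|xy] fd; first by exists y; [exact: betweenl | rewrite !subrr mulr0].
have bE r : r \in `[x, y] -> between x y r.
  by rewrite in_itv /between /= (min_idPl (ltW xy)) (max_idPr (ltW xy)).
have [|| c cP E] := @MVT _ f df x y xy.
- by move=> r rP; apply/fd/bE; apply: subset_itv_oo_cc.
- by apply: derivable_within_continuous => r /bE/fd [].
by exists c => //; apply/bE/subset_itv_oo_cc.
Qed.

(** The mean value theorem raises the order of vanishing at [x] by one. Iterated, it yields Taylor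
    inequalities, without the factorials in the remainder. *)
Lemma MVT_bound f df x y K (n : nat) :
  (forall r, between x y r -> is_derive r 1 f (df r)) ->
  (forall r, between x y r -> `|df r| <= K * `|r - x| ^+ n) ->
  `|f y - f x| <= K * `|y - x| ^+ n.+1.
Proof.
move=> fd dfK; have [c cP ->] := MVT_between fd.
rewrite normrM exprSr mulrA ler_wpM2r//; apply: (le_trans (dfK _ cP)).
(* The remaining monotonicity depends on the sign of [K], which is read off from the derivative
   bound at [y] if [c] is [x], and at [c] otherwise. *)
have [xc|xc] := eqVneq c x.
  have [yx|yx] := eqVneq y x; first by rewrite xc yx.
  have := dfK _ (betweenr x y); case: n {dfK} => [|n] dfK; first by rewrite !expr0.
  rewrite xc subrr normr0 expr0n mulr0; exact: le_trans dfK.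
have := le_trans (normr_ge0 _) (dfK _ cP).
rewrite pmulr_lge0 ?exprn_gt0 ?normr_gt0 ?subr_eq0// => K0.
by rewrite ler_wpM2l// lerXn2r ?nnegrE//; exact: between_dist.
Qed.

Variables (phi0 phi1 phi2 : R -> R).

Lemma taylor1 x y M :
  (forall r, between x y r -> is_derive r 1 phi0 (phi1 r)) ->
  (forall r, between x y r -> `|phi1 r| <= M) ->
  `|phi0 y - phi0 x| <= M * `|y - x|.
Proof.
move=> d0 bM; rewrite -[`|y - x|]expr1; apply: MVT_bound d0 _ => r rP.
by rewrite expr0 mulr1; exact: bM.
Qed.

Lemma taylor2 x y M :
  (forall r, between x y r -> is_derive r 1 phi0 (phi1 r)) ->
  (forall r, between x y r -> is_derive r 1 phi1 (phi2 r)) ->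
  (forall r, between x y r -> `|phi2 r| <= M) ->
  `|phi0 y - phi0 x - phi1 x * (y - x)| <= M * `|y - x| ^+ 2.
Proof.
move=> d0 d1 bM.
pose f r := phi0 r - phi1 x * (r - x).
have -> : phi0 y - phi0 x - phi1 x * (y - x) = f y - f x by rewrite /f; ring.
apply: (@MVT_bound _ (fun r => phi1 r - phi1 x)) => r rP.
  have ? := d0 r rP.
  have -> : f = phi0 - (phi1 x *: (id - cst x)) by [].
  by apply: is_derive_eq; rewrite subr0 /GRing.scale /= mulr1.
rewrite expr1; have := @MVT_bound phi1 phi2 x r M 0; rewrite expr1; apply.
  by move=> s sP; apply: d1; apply: between_trans sP.
by move=> s sP; rewrite expr0 mulr1; apply: bM; apply: between_trans sP.
Qed.

End Taylor1D.

Lemma taylor3 (R : realType) (phi0 phi1 phi2 phi3 : R -> R) (x y M : R) :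
  (forall r, Num.min x y <= r <= Num.max x y -> is_derive r 1 phi0 (phi1 r)) ->
  (forall r, Num.min x y <= r <= Num.max x y -> is_derive r 1 phi1 (phi2 r)) ->
  (forall r, Num.min x y <= r <= Num.max x y -> is_derive r 1 phi2 (phi3 r)) ->
  (forall r, Num.min x y <= r <= Num.max x y -> `|phi3 r| <= M) ->
  `|phi0 y - phi0 x - phi1 x * (y - x) - phi2 x / 2 * (y - x) ^+ 2|
    <= M * `|y - x| ^+ 3.
Proof.
move=> d0 d1 d2 bM.
pose f r := phi0 r - phi1 x * (r - x) - phi2 x / 2 * (r - x) ^+ 2.
have -> : phi0 y - phi0 x - phi1 x * (y - x) - phi2 x / 2 * (y - x) ^+ 2 = f y - f x.
  by rewrite /f; ring.
apply: (@MVT_bound _ _ (fun r => phi1 r - phi1 x - phi2 x * (r - x))) => r rP.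
  have ? := d0 r rP.
  have -> : f = phi0 - (phi1 x *: (id - cst x)) - ((phi2 x / 2) *: ((id - cst x) ^+ 2)) by [].
  apply: is_derive_eq; rewrite subr0 /GRing.scale /= !mulr1 expr1.
  rewrite mulrA divfK//.
apply: (@taylor2 _ phi1 phi2 phi3) => s sP; [apply: d1|apply: d2|apply: bM];
  exact: between_trans sP.
Qed.

(** * Sums over dependent finite functions *)

Section DffunSums.
Context {R : realFieldType} {I : finType} (T_ : I -> finType).
Variable w : forall i, T_ i -> R.
Arguments w : clear implicits.

Definition dffun_upd (f : {dffun forall i, T_ i}) k (m : T_ k) :
    {dffun forall i, T_ i} :=
  finfun (dfwith f k m).

Lemma dffun_upd_in f k m : @dffun_upd f k m k = m.
Proof. by rewrite ffunE dfwithin. Qed.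

Lemma dffun_upd_out f k m l : l != k -> @dffun_upd f k m l = f l.
Proof. by move=> lk; rewrite ffunE dfwithout// eq_sym. Qed.

(** Distributivity for a dependent family of index sets: it factors sums of tensor-product weights
    into one-dimensional sums. *)
Lemma sum_prod_dffun :
  \sum_(f : {dffun forall i, T_ i}) \prod_i w i (f i) = \prod_i \sum_j w i j.
Proof.
rewrite (reindex (@dffun_of_fprod _ T_)); last exact/onW_bij/dffun_of_fprod_bij.
transitivity (\sum_(t : fprod T_) \prod_i w i (t i)).
  by apply: eq_bigr => t _; apply: eq_bigr => i _; rewrite /dffun_of_fprod ffunE.
(* Summing over the tagged union of all [T_ i] turns the dependent family into an ordinary one, to
   which the usual distributivity applies. *)
under [RHS]eq_bigr do rewrite (big_tag (fun i => w i)).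
rewrite bigA_distr_big_dep /=.
have := @big_fprod R 0 1 *%R +%R I T_ (fun i => [ffun j => w i j]).
move=> /= E; transitivity (\sum_(t : fprod T_) \prod_i [ffun j => w i j] (t i)).
  by apply: eq_bigr => t _; apply: eq_bigr => i _; rewrite ffunE.
rewrite E; apply: eq_bigr => f fP; apply: eq_bigr => i _.
by case: (f i) => j t; rewrite /untag /=; case: eqP => // e; rewrite ffunE.
Qed.

(** If the weights of coordinate [k] have total mass 1, an independent resampling of that coordinate
    does not change the weighted sum. *)
Lemma dffun_average k (Phi : {dffun forall i, T_ i} -> R) :
  \sum_m w k m = 1 ->
  \sum_(f : {dffun forall i, T_ i}) (\prod_i w i (f i)) * Phi f =
  \sum_(f : {dffun forall i, T_ i})
    (\prod_i w i (f i)) * \sum_m w k m * Phi (dffun_upd f m).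
Proof.
move=> w1; transitivity (\sum_(f : {dffun forall i, T_ i}) \sum_m
  (\prod_i w i (f i)) * Phi f * w k m).
  by apply: eq_bigr => f _; rewrite -mulr_sumr w1 mulr1.
under [RHS]eq_bigr do rewrite mulr_sumr.
rewrite !pair_bigA /=.
(* This involution exchanges the coordinate [k] of the index with the independent sample, and the
   total weight is symmetric in the two. *)
pose s (q : {dffun forall i, T_ i} * T_ k) := (dffun_upd q.1 q.2, q.1 k).
have sK : involutive s.
  case=> f m; rewrite /s /= dffun_upd_in; congr (_, _); apply/ffunP => l.
  have [->|lk] := eqVneq l k; first by rewrite dffun_upd_in.
  by rewrite !dffun_upd_out.
rewrite (reindex_inj (inv_inj sK)) /=; apply: eq_bigr => -[f m] _ /=.
rewrite (bigD1 k)//= [in RHS](bigD1 k)//= dffun_upd_in.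
under eq_bigr => l lk do rewrite dffun_upd_out//.
by ring.
Qed.

End DffunSums.

(** * The closed space-time cylinder *)

Section ClosedCylinder.
Context {R : realType} {d : nat} (a : 'I_d -> R) (T : R).
Hypotheses (ha : forall k, 0 < a k) (hT : 0 < T).
Local Notation pt := ('rV[R]_d * R)%type.
Implicit Types (z w : pt) (k l : option 'I_d).

(** Space and time are treated alike: the cylinder is a box in dimension d + 1. *)
Definition coord k z : R := if k is Some j then z.1 0 j else z.2.
Definition extent k : R := if k is Some j then a j else T.

Lemma coord_inj z w : (forall k, coord k z = coord k w) -> z = w.
Proof.
case: z w => [x t] [y s] E; congr (_, _); last exact: (E None).
by apply/rowP => j; exact: (E (Some j)).
Qed.

Lemma coordD k z w : coord k (z + w) = coord k z + coord k w.
Proof. by case: k => [j|] //=; rewrite mxE. Qed.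

Lemma coordZ k r z : coord k (r *: z) = r * coord k z.
Proof. by case: k => [j|] //=; rewrite mxE. Qed.

Lemma coord_dir k l : coord k (dir l) = (k == l)%:R :> R.
Proof. by case: k l => [j|] [i|] //=; rewrite mxE ?eqxx. Qed.

Lemma extent_gt0 k : 0 < extent k.
Proof. by case: k => [j|] /=. Qed.

Lemma cylE z : cyl a T z <-> forall k, 0 < coord k z < extent k.
Proof.
case: z => x t; rewrite /cyl /Omega /=; split.
  by move=> [/= xP]; rewrite in_itv /= => tP [j|]; [exact: xP|exact: tP].
by move=> zP; split; [move=> j; exact: (zP (Some j)) | rewrite /= in_itv; exact: (zP None)].
Qed.

Definition center : pt := (\row_j (a j / 2), T / 2).

Lemma coord_center k : coord k center = extent k / 2.
Proof. by case: k => [j|] //=; rewrite mxE. Qed.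

(** The contraction towards the centre moves the closed cylinder into the open one for 0 < r < 1.
    Letting r tend to 0 carries interior estimates to the boundary. *)
Definition shrink (r : R) z : pt := z + r *: (center - z).

Lemma coord_shrink k r z : coord k (shrink r z) = (1 - r) * coord k z + r * (extent k / 2).
Proof.
by rewrite /shrink coordD coordZ -scaleN1r coordD coordZ coord_center; ring.
Qed.

Lemma shrink_interior r z : (forall k, 0 <= coord k z <= extent k) -> 0 < r < 1 ->
  cyl a T (shrink r z).
Proof.
move=> zP /andP[r0 r1]; apply/cylE => k; rewrite coord_shrink.
have /andP[z0 z1] := zP k; have := extent_gt0 k => e0.
have ? : 0 <= (1 - r) * coord k z by rewrite mulr_ge0// subr_ge0 ltW.
have ? : (1 - r) * coord k z <= (1 - r) * extent k by rewrite ler_wpM2l// subr_ge0 ltW.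
have ? : 0 < r * extent k by rewrite mulr_gt0.
by apply/andP; split; lra.
Qed.

Lemma shrink_cvg z : shrink r z @[r --> 0^'+] --> z.
Proof.
have E : z = z + 0 *: (center - z) by rewrite scale0r addr0.
rewrite {2}E; apply: cvg_within_filter; apply: cvgD; first exact: cvg_cst.
by apply: cvgZ; [exact: cvg_id|exact: cvg_cst].
Qed.

Lemma closure_OmegaE x : closure (Omega a) x <-> forall j, 0 <= x 0 j <= a j.
Proof.
split=> [xO j|xP].
  have cj : closed [set y : 'rV[R]_d | 0 <= y 0 j <= a j].
    rewrite (_ : [set _ | _] = (fun y : 'rV[R]_d => y 0 j) @^-1` `[0, a j]).
      apply: preimage_closed; last exact: itv_closed.
      by move=> ? _; exact: coord_continuous.
    by apply/seteqP; split => y /=; rewrite in_itv.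
  have /closure_subset/(_ x xO) : Omega a `<=` [set y : 'rV[R]_d | 0 <= y 0 j <= a j].
    by move=> y /(_ j)/andP[? ?] /=; rewrite !ltW.
  by rewrite -(closure_id _).1.
(* The time [T / 2] is a dummy that makes the space-time contraction available for a point of
   space. *)
have zP k : 0 <= coord k (x, T / 2) <= extent k.
  by case: k => [j|] //=; move: hT; lra.
have sx : (shrink r (x, T / 2)).1 @[r --> 0^'+] --> x.
  apply: (@cvg_comp _ _ _ (shrink^~ (x, T / 2)) fst _ _ _ (@shrink_cvg (x, T / 2))).
  exact: cvg_fst.
move=> B xB; have : \forall r \near 0^'+, B (shrink r (x, T / 2)).1 := sx B xB.
move=> Br; near (0 : R)^'+ => r.
exists (shrink r (x, T / 2)).1; split; last by near: r.
by have [] : cyl a T (shrink r (x, T / 2)) by apply: shrink_interior => //; apply/andP; split.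
Unshelve. all: by end_near. Qed.

Lemma ccylE z : ccyl a T z <-> forall k, 0 <= coord k z <= extent k.
Proof.
case: z => x t; rewrite /ccyl /=; split.
  by move=> [/= /closure_OmegaE xP]; rewrite in_itv /= => tP [j|]; [exact: xP|exact: tP].
move=> zP; split; last by rewrite /= in_itv; exact: (zP None).
by apply/closure_OmegaE => j; exact: (zP (Some j)).
Qed.

Lemma cyl_ccyl : cyl a T `<=` ccyl a T.
Proof. by move=> z /cylE zP; apply/ccylE => k; case/andP: (zP k) => ? ?; rewrite !ltW. Qed.

Lemma ccyl_compact : compact (ccyl a T).
Proof.
apply: compact_setX; last exact: segment_compact.
rewrite (_ : closure _ = [set x : 'rV[R]_d | forall j, `[0, a j]%classic (x ord0 j)]).
  by apply: (@rV_compact R d (fun j => `[0, a j]%classic)) => j; exact: segment_compact.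
apply/seteqP; split => x /=.
  by move/closure_OmegaE => xP j; rewrite /= in_itv; exact: xP.
by move=> xP; apply/closure_OmegaE => j; move: (xP j); rewrite /= in_itv.
Qed.

Lemma within_ccyl_bounded (g : pt -> R) : {within ccyl a T, continuous g} ->
  exists M, forall z, ccyl a T z -> `|g z| <= M.
Proof.
move=> /continuous_compact/(_ ccyl_compact)/compact_bounded [M [_ MP]].
by exists (M + 1) => z zK; apply: (MP (M + 1)); [rewrite ltrDl | exists z].
Qed.

Lemma shrink_cvg_within (g : pt -> R) z : {within ccyl a T, continuous g} ->
  ccyl a T z -> g (shrink r z) @[r --> 0^'+] --> g z.
Proof.
move=> /subspace_continuousP gc zK; apply: (cvg_comp _ _ _ (gc z zK)).
move=> B; rewrite /within /= => Bz.
have Br : \forall r \near 0^'+, ccyl a T (shrink r z) -> B (shrink r z) := shrink_cvg Bz.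
near=> r; have : ccyl a T (shrink r z).
  by apply/cyl_ccyl/shrink_interior; [apply/ccylE | apply/andP; split].
by near: r.
Unshelve. all: by end_near. Qed.

(** Each point of the closed cylinder is the limit of its shrunken copies, so limits taken from the
    open cylinder are unique there. *)
Lemma within_cyl_proper z : ccyl a T z -> ProperFilter (within (cyl a T) (nbhs z)).
Proof.
move=> zK; apply: Build_ProperFilter_ex => B; rewrite /within /= => Bz.
have Br : \forall r \near 0^'+, cyl a T (shrink r z) -> B (shrink r z) := shrink_cvg Bz.
near (0 : R)^'+ => r; exists (shrink r z).
have : cyl a T (shrink r z) by apply: shrink_interior; [apply/ccylE|apply/andP; split].
by near: r.
Unshelve. all: by end_near. Qed.

End ClosedCylinder.

(** * Derivatives extended to the closed cylinder *)

(** Only finitely many words have length at most [n]; hence one constant bounds all partial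
    derivatives up to a given order. *)
Lemma seq_sup (R : realType) (K : finType) (B : seq K -> R) n :
  exists M, forall s, (size s <= n)%N -> B s <= M.
Proof.
elim: n B => [|n IH] B; first by exists (B [::]) => s; rewrite leqn0 size_eq0 => /eqP ->.
have /choice[Mk MkP] k : exists M, forall s, (size s <= n)%N -> B (k :: s) <= M.
  exact: (IH (fun s => B (k :: s))).
exists (`|B [::]| + \sum_k `|Mk k|) => -[_|k s /= sn].
  by rewrite (le_trans (ler_norm _))// lerDl sumr_ge0.
rewrite (le_trans (MkP _ _ sn))// (le_trans (ler_norm _))//.
by rewrite (bigD1 k)//= addrCA lerDl addr_ge0// sumr_ge0.
Qed.

Lemma is_derive_line (R : realType) (V : normedModType R) (F : V -> R) z e (r : R) :
  derivable F (z + r *: e) e ->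
  is_derive r 1 (fun r => F (z + r *: e)) ('D_e F (z + r *: e)).
Proof.
have E : (fun h : R => h^-1 *: (((fun r => F (z + r *: e)) \o shift r) (h *: 1)
    - F (z + r *: e)))
  = (fun h => h^-1 *: ((F \o shift (z + r *: e)) (h *: e) - F (z + r *: e))).
  by apply/funext => h /=; rewrite -[h *: 1]/(h * 1) mulr1 scalerDl addrCA.
by move=> dF; split; rewrite /derivable /derive E.
Qed.

Section Jets.
Context {R : realType} {d : nat} (a : 'I_d -> R) (T : R).
Hypotheses (ha : forall k, 0 < a k) (hT : 0 < T).
Local Notation pt := ('rV[R]_d * R)%type.
Implicit Types (z w : pt) (k l : option 'I_d) (s : seq (option 'I_d)).
Implicit Types (f : pt -> R) (G : seq (option 'I_d) -> pt -> R).

(** [G] collects continuous extensions of the partial derivatives, indexed by words of directions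
    with the outermost derivative first. Requiring [G [::]] to be [f] keeps the boundary values of
    [f]. *)
Definition jet m f G (M : R) : Prop :=
  G [::] = f /\ forall s, (size s <= m)%N ->
    [/\ {within ccyl a T, continuous (G s)},
        forall z, ccyl a T z -> `|G s z| <= M
      & forall z, cyl a T z -> G s z = partials s f z].

Lemma smooth_jet m f : smooth_fun a T m f -> exists G M, jet m f G M.
Proof.
move=> [f0 fs].
(* The empty word receives [f] itself, the other words any continuous extension. *)
have /choice[G GP] s : exists g, (s = [::] -> g = f) /\ ((size s <= m)%N ->
    {within ccyl a T, continuous g} /\ forall z, cyl a T z -> g z = partials s f z).
  have [sm|/negP sm] := boolP (size s <= m)%N.
    case: s sm => [|k s] sm; first by exists f.
    by have [_ [g gP]] := fs _ sm; exists g.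
  by exists f; split => // /sm.
have /choice[B BP] s : exists M, (size s <= m)%N -> forall z, ccyl a T z -> `|G s z| <= M.
  have [/(GP s).2[gc _]|/negP sm] := boolP (size s <= m)%N; last by exists 0.
  by have [M MP] := within_ccyl_bounded ha hT gc; exists M.
have [M MP] := seq_sup B m.
exists G, M; split; first exact: (GP [::]).1.
move=> s sm; have [gc gE] := (GP s).2 sm; split => // z zK.
exact: le_trans (BP s sm z zK) (MP s sm).
Qed.

Lemma line_cyl z k (tau r : R) : cyl a T z -> cyl a T (z + tau *: dir k) ->
  Num.min 0 tau <= r <= Num.max 0 tau -> cyl a T (z + r *: dir k).
Proof.
move=> /cylE z0 /cylE z1 rP; apply/cylE => l.
move: (z0 l) (z1 l); rewrite !coordD !coordZ !coord_dir.
case: (l == k); rewrite ?mulr0 ?mulr1// => h0 h1.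
by move: rP; rewrite ge_min le_max => /andP[/orP[] ? /orP[] ?]; lra.
Qed.

Lemma shrink_line r z tau k :
  shrink a T r (z + tau *: dir k) = shrink a T r z + ((1 - r) * tau) *: dir k.
Proof.
apply: coord_inj => l.
by rewrite coordD !coord_shrink coordD !coordZ; ring.
Qed.

Variables (m : nat) (f : pt -> R) (G : seq (option 'I_d) -> pt -> R) (M : R).
Hypotheses (fsm : smooth_fun a T m f) (jG : jet m f G M).

Let P s := partials s f.
Local Notation sh := (shrink a T).

Lemma partials_line s k z (r : R) : (size s < m)%N -> cyl a T (z + r *: dir k) ->
  is_derive r 1 (fun r => P s (z + r *: dir k)) (P (k :: s) (z + r *: dir k)).
Proof.
move=> sm zr; apply: is_derive_line; have [_ /(_ s (ltnW sm))[ds _]] := fsm.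
exact: ds.
Qed.

Lemma jet_open s z : (size s <= m)%N -> cyl a T z -> G s z = P s z.
Proof. by move=> sm zP; have [_ /(_ s sm)[_ _]] := jG; exact. Qed.

Lemma jet_bound s z : (size s <= m)%N -> ccyl a T z -> `|G s z| <= M.
Proof. by move=> sm zP; have [_ /(_ s sm)[_ + _]] := jG; exact. Qed.

Lemma partials_bound s z : (size s <= m)%N -> cyl a T z -> `|P s z| <= M.
Proof. by move=> sm zP; rewrite -jet_open//; apply: jet_bound => //; exact: cyl_ccyl. Qed.

Lemma jet_cvg s z : (size s <= m)%N -> ccyl a T z ->
  G s (shrink a T r z) @[r --> 0^'+] --> G s z.
Proof.
by move=> sm zP; have [_ /(_ s sm)[gc _ _]] := jG; exact: shrink_cvg_within.
Qed.

Let cvg1r (tau : R) : ((1 - r) * tau) @[r --> 0^'+] --> tau.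
Proof.
have {2}-> : tau = (1 - 0) * tau by rewrite subr0 mul1r.
by apply: cvg_within_filter; apply: cvgM; [apply: cvgB|]; (try exact: cvg_cst); exact: cvg_id.
Qed.

(** This is how inequalities reach the boundary: they are shown at the two shrunken points, where
    classical derivatives exist, and pass to the limit. *)
Lemma jet_shrink z z' (A B : R -> R) (A0 B0 : R) :
  ccyl a T z -> ccyl a T z' ->
  A r @[r --> 0^'+] --> A0 -> B r @[r --> 0^'+] --> B0 ->
  (forall r, cyl a T (shrink a T r z) -> cyl a T (shrink a T r z') -> A r <= B r) ->
  A0 <= B0.
Proof.
move=> /(ccylE ha hT) zK /(ccylE ha hT) zK' cA cB AB.
apply: (ler_cvg_to cA cB); near=> r.
by apply: AB; apply: (shrink_interior ha hT) => //; apply/andP; split.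
Unshelve. all: by end_near. Qed.

Variables (k : option 'I_d) (z : pt) (tau : R).
Hypotheses (zK : ccyl a T z) (zK' : ccyl a T (z + tau *: dir k)).

(** Shrinking produces a parallel segment of signed length [(1 - r) * tau] inside the open cylinder,
    where the one-dimensional Taylor inequality applies. The next two lemmas do the same at higher
    order. *)
Lemma jet_line1 s : (size s < m)%N ->
  `|G s (z + tau *: dir k) - G s z| <= M * `|tau|.
Proof.
move=> sm; apply: (jet_shrink zK zK'
  (A := fun r => `|G s (sh r (z + tau *: dir k)) - G s (sh r z)|)
  (B := fun r => M * `|(1 - r) * tau|)).
- by apply: cvg_norm; apply: cvgB; apply: jet_cvg => //; exact: ltnW.
- by apply: cvgM; [exact: cvg_cst|apply: cvg_norm; exact: cvg1r].
move=> r /= rK rK'; rewrite !jet_open ?(ltnW sm)//.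
move: rK'; rewrite shrink_line; set t := (1 - r) * tau => rK'.
have := @taylor1 _ (fun r' => P s (shrink a T r z + r' *: dir k))
  (fun r' => P (k :: s) (shrink a T r z + r' *: dir k)) 0 t M.
rewrite !scale0r !addr0 !subr0; apply => r' /(line_cyl rK rK') r'K.
  exact: partials_line.
exact: partials_bound.
Qed.

Lemma jet_line2 s : (size s + 2 <= m)%N ->
  `|G s (z + tau *: dir k) - G s z - G (k :: s) z * tau| <= M * `|tau| ^+ 2.
Proof.
rewrite addn2 => sm; apply: (jet_shrink zK zK'
  (A := fun r => `|G s (sh r (z + tau *: dir k)) - G s (sh r z)
      - G (k :: s) (sh r z) * ((1 - r) * tau)|)
  (B := fun r => M * `|(1 - r) * tau| ^+ 2)).
- apply: cvg_norm; apply: cvgB; first by apply: cvgB; apply: jet_cvg => //=; lia.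
  by apply: cvgM; [apply: jet_cvg => //=; lia | exact: cvg1r].
- apply: cvgM; first exact: cvg_cst.
  by rewrite !expr2; apply: cvgM; apply: cvg_norm; exact: cvg1r.
move=> r /= rK rK'; rewrite !jet_open /=; (try lia); (try by []).
move: rK'; rewrite shrink_line; set t := (1 - r) * tau => rK'.
have := @taylor2 _ (fun r' => P s (shrink a T r z + r' *: dir k))
  (fun r' => P (k :: s) (shrink a T r z + r' *: dir k))
  (fun r' => P (k :: k :: s) (shrink a T r z + r' *: dir k)) 0 t M.
rewrite !scale0r !addr0 !subr0; apply => r' /(line_cyl rK rK') r'K.
- by apply: partials_line => //; lia.
- by apply: partials_line => //=; lia.
- by apply: partials_bound => //=; lia.
Qed.

Lemma jet_line3 s : (size s + 3 <= m)%N ->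
  `|G s (z + tau *: dir k) - G s z - G (k :: s) z * tau
      - G (k :: k :: s) z / 2 * tau ^+ 2| <= M * `|tau| ^+ 3.
Proof.
rewrite addn3 => sm; apply: (jet_shrink zK zK'
  (A := fun r => `|G s (sh r (z + tau *: dir k)) - G s (sh r z)
      - G (k :: s) (sh r z) * ((1 - r) * tau)
      - G (k :: k :: s) (sh r z) / 2 * ((1 - r) * tau) ^+ 2|)
  (B := fun r => M * `|(1 - r) * tau| ^+ 3)).
- apply: cvg_norm; apply: cvgB; first apply: cvgB.
  + by apply: cvgB; apply: jet_cvg => //=; lia.
  + by apply: cvgM; [apply: jet_cvg => //=; lia | exact: cvg1r].
  + apply: cvgM; last by rewrite !expr2; apply: cvgM; exact: cvg1r.
    by apply: cvgM; [apply: jet_cvg => //=; lia | exact: cvg_cst].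
- apply: cvgM; first exact: cvg_cst.
  rewrite (exprS _ 2) expr2; apply: cvgM; last apply: cvgM;
    apply: cvg_norm; exact: cvg1r.
move=> r /= rK rK'; rewrite !jet_open /=; (try lia); (try by []).
move: rK'; rewrite shrink_line; set t := (1 - r) * tau => rK'.
have := @taylor3 _ (fun r' => P s (shrink a T r z + r' *: dir k))
  (fun r' => P (k :: s) (shrink a T r z + r' *: dir k))
  (fun r' => P (k :: k :: s) (shrink a T r z + r' *: dir k))
  (fun r' => P (k :: k :: k :: s) (shrink a T r z + r' *: dir k)) 0 t M.
rewrite !scale0r !addr0 !subr0; apply => r' /(line_cyl rK rK') r'K.
- by apply: partials_line => //; lia.
- by apply: partials_line => //=; lia.
- by apply: partials_line => //=; lia.
- by apply: partials_bound => //=; lia.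
Qed.

End Jets.

(** On the open cylinder the derivative equals [G [:: k]], and continuity of the latter on the
    closed cylinder supplies the limit. *)
Lemma jet_pderiv (R : realType) (d : nat) (a : 'I_d -> R) (T : R)
    (ha : forall k, 0 < a k) (hT : 0 < T) m r c (F : 'rV[R]_d * R -> 'M[R]_(r, c))
    i j G M k z :
  (0 < m)%N -> jet a T m (fun z => F z i j) G M -> ccyl a T z ->
  pderiv a T k F z i j = G [:: k] z.
Proof.
move=> m0 [_ /(_ [:: k] m0)[/subspace_continuousP gc _ gE]] zK.
rewrite mxE; have := within_cyl_proper ha hT zK => FF.
apply: cvg_lim; first exact: Rhausdorff.
apply: cvg_trans (gc z zK) => B Bz.
have Bz' : nbhs z (fun w => ccyl a T w -> B (G [:: k] w)) := Bz.
change (nbhs z (fun w => cyl a T w -> B ('D_(dir k) (fun z0 => F z0 i j) w))).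
apply: filterS Bz' => w wB wK.
by move: (wB (cyl_ccyl ha hT wK)); rewrite gE.
Qed.

(** * Taylor expansions along a displacement in several directions *)

Section JetTaylor.
Context {R : realType} {d : nat} (a : 'I_d -> R) (T : R).
Hypotheses (ha : forall k, 0 < a k) (hT : 0 < T).
Local Notation pt := ('rV[R]_d * R)%type.
Local Notation dirs := (option 'I_d).
Implicit Types (z w : pt) (k l : dirs) (s ks : seq dirs).
Variables (f : pt -> R) (G : seq dirs -> pt -> R) (M V : R).
Hypotheses (fsm : smooth_fun a T 3 f) (jG : jet a T 3 f G M).
Hypotheses (M0 : 0 <= M) (V0 : 0 <= V).

(** The list [ks] holds the directions in which the point has moved; the expansions below are proved
    by induction on it. *)
Definition displaced ks (v : dirs -> R) (tau : R) z z' :=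
  forall l, coord l z' = coord l z + (if l \in ks then tau * v l else 0).

(* One coordinate at a time: the domain being a box, the corners of the staircase
   from [z] to [z'] stay in it. *)
Lemma displaced_cons k ks v tau z z' : k \notin ks ->
  ccyl a T z -> ccyl a T z' -> displaced (k :: ks) v tau z z' ->
  exists z'', [/\ ccyl a T z'', displaced ks v tau z z''
    & z' = z'' + (tau * v k) *: dir k].
Proof.
move=> kks zK z'K zz'; pose z'' := z' + (- (tau * v k)) *: dir k.
have c'' l : coord l z'' = if l == k then coord l z else coord l z'.
  rewrite /z'' coordD coordZ coord_dir; case: eqP => [->|_]; last by rewrite mulr0 addr0.
  by rewrite zz' inE eqxx /= mulr1 addrK.
exists z''; split.
- apply/(ccylE ha hT) => l; rewrite c''; case: ifP => _.
    exact: (ccylE ha hT _).1.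
  exact: (ccylE ha hT _).1.
- move=> l; rewrite c''; have [->|lk] := eqVneq l k; first by rewrite (negPf kks) addr0.
  by rewrite zz' inE (negPf lk).
- by apply: coord_inj => l; rewrite /z'' !coordD !coordZ; ring.
Qed.

Lemma displaced_nil v tau z z' : displaced [::] v tau z z' -> z' = z.
Proof. by move=> zz'; apply: coord_inj => l; rewrite zz' addr0. Qed.

Lemma jet_taylor1 ks : uniq ks -> exists2 C, 0 <= C &
  forall s z z' v tau, (size s < 3)%N -> ccyl a T z -> ccyl a T z' ->
    (forall k, `|v k| <= V) -> displaced ks v tau z z' ->
    `|G s z' - G s z| <= C * `|tau|.
Proof.
elim: ks => [_|k ks IH /=/andP[kks /IH[C C0 CP]]].
  by exists 0 => // s z z' v tau _ _ _ _ /displaced_nil ->; rewrite subrr normr0 mul0r.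
exists (C + M * V) => [|s z z' v tau sm zK z'K vV zz'].
  by rewrite addr_ge0// mulr_ge0.
have [w [wK zw z'E]] := displaced_cons kks zK z'K zz'.
rewrite z'E in z'K *.
have := jet_line1 ha hT fsm jG wK z'K sm; have := CP s z w v tau sm zK wK vV zw.
set A := G s (w + _); set B := G s w; set D := G s z => h1 h2.
have -> : A - D = (A - B) + (B - D) by ring.
apply: (le_trans (ler_normD _ _)); rewrite mulrDl addrC lerD//.
apply: (le_trans h2); rewrite -mulrA ler_wpM2l// normrM mulrC ler_wpM2r//.
Qed.

(** The last leg is expanded at the corner [w]. Its derivative is then replaced by the one at [z],
    which costs O(tau) by the first-order estimate and is multiplied by [tau]. *)
Lemma jet_taylor2 ks : uniq ks -> exists2 C, 0 <= C &
  forall s z z' v tau, (size s < 2)%N -> ccyl a T z -> ccyl a T z' ->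
    (forall k, `|v k| <= V) -> displaced ks v tau z z' ->
    `|G s z' - G s z - tau * \sum_(k <- ks) v k * G (k :: s) z| <= C * `|tau| ^+ 2.
Proof.
elim: ks => [_|k ks IH /=/andP[kks uks]].
  exists 0 => // s z z' v tau _ _ _ _ /displaced_nil ->.
  by rewrite big_nil mulr0 subrr subr0 normr0 mul0r.
have [C C0 CP] := IH uks; have [C1 C10 CP1] := jet_taylor1 uks.
exists (C + V * C1 + M * V ^+ 2) => [|s z z' v tau sm zK z'K vV zz'].
  by rewrite !addr_ge0 ?mulr_ge0 ?exprn_ge0.
have [w [wK zw z'E]] := displaced_cons kks zK z'K zz'.
rewrite z'E in z'K *.
have sm2 : (size s + 2 <= 3)%N by rewrite addn2.
have := jet_line2 ha hT fsm jG wK z'K sm2; have := CP s z w v tau sm zK wK vV zw.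
have /= := CP1 (k :: s) z w v tau sm zK wK vV zw.
rewrite big_cons; set A := G s (w + _); set B := G s w; set D := G s z.
set S := \sum_(_ <- _) _; set Bk := G (k :: s) w; set Dk := G (k :: s) z => h1 h2 h3.
have -> : A - D - tau * (v k * Dk + S) = (B - D - tau * S)
  + v k * (tau * (Bk - Dk)) + (A - B - Bk * (tau * v k)) by ring.
apply: (le_trans (ler_normD _ _)); rewrite mulrDl lerD//.
  apply: (le_trans (ler_normD _ _)); rewrite mulrDl lerD// normrM -mulrA.
  by apply: ler_pM => //; rewrite normrM expr2 mulrCA ler_wpM2l.
apply: (le_trans h3); rewrite -mulrA ler_wpM2l// -exprMn lerXn2r ?nnegrE ?mulr_ge0//.
by rewrite normrM mulrC ler_wpM2r.
Qed.

(** The second-order coefficient [A] is chosen before [z'] and [tau]. One [A] thus serves the steps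
    [dt] and [2 * dt], as the cancellation in the backward difference demands. *)
Lemma jet_taylor3 ks : uniq ks -> exists2 C, 0 <= C &
  forall z v, ccyl a T z -> (forall k, `|v k| <= V) -> exists2 A, `|A| <= C &
  forall z' tau, ccyl a T z' -> displaced ks v tau z z' ->
    `|f z' - f z - tau * \sum_(k <- ks) v k * G [:: k] z - tau ^+ 2 * A|
      <= C * `|tau| ^+ 3.
Proof.
have fE : G [::] = f by case: jG.
rewrite -fE; elim: ks => [_|k ks IH /=/andP[kks uks]].
  exists 0 => // z v _ _; exists 0 => [|z' tau _ /displaced_nil ->]; first by rewrite normr0.
  by rewrite big_nil !mulr0 subrr !subr0 normr0 mul0r.
have [C C0 CP] := IH uks; have [C1 C10 CP1] := jet_taylor1 uks.
have [C2 C20 CP2] := jet_taylor2 uks.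
pose E1 := V * C2 + V ^+ 2 * C1 + M * V ^+ 3.
pose E2 := V * ((size ks)%:R * (V * M)) + V ^+ 2 * M.
have E10 : 0 <= E1 by rewrite !addr_ge0 ?mulr_ge0 ?exprn_ge0.
have E20 : 0 <= E2 by rewrite !addr_ge0 ?mulr_ge0 ?exprn_ge0.
exists (C + E1 + E2) => [|z v zK vV]; first by rewrite addr_ge0// addr_ge0.
have [A AC AP] := CP z v zK vV.
set S2 := \sum_(j <- ks) v j * G [:: j; k] z.
have S2b : `|S2| <= (size ks)%:R * (V * M).
  rewrite /S2; elim: (ks) => [|j r IHr]; first by rewrite big_nil normr0 mul0r.
  rewrite big_cons /= -natr1 mulrDl mul1r addrC; apply: (le_trans (ler_normD _ _)).
  rewrite lerD// normrM; apply: ler_pM => //; exact: (jet_bound jG).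
have V2 : `|v k ^+ 2| <= V ^+ 2 by rewrite normrX lerXn2r ?nnegrE.
(* Half the second derivative along [v]: the part from the earlier directions, the mixed terms with
   [k], and the pure term in [k]. *)
exists (A + v k * S2 + v k ^+ 2 / 2 * G [:: k; k] z).
  have -> : C + E1 + E2 = C + V * ((size ks)%:R * (V * M)) + V ^+ 2 * M + E1.
    by rewrite /E2; ring.
  rewrite -[leLHS]addr0; apply: lerD => //.
  apply: (le_trans (ler_normD _ _)); apply: lerD.
    apply: (le_trans (ler_normD _ _)); apply: lerD => //.
    by rewrite normrM; apply: ler_pM.
  rewrite normrM; apply: ler_pM => //; last exact: (jet_bound jG).
  by rewrite normrM [`|2^-1|]ger0_norm// (le_trans _ V2)// ler_piMr//; lra.
move=> z' tau z'K zz'.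
have [w [wK zw z'E]] := displaced_cons kks zK z'K zz'.
rewrite z'E in z'K *.
have := jet_line3 ha hT fsm jG wK z'K (isT : (size [::] + 3 <= 3)%N).
have := AP w tau wK zw.
have := CP2 [:: k] z w v tau isT zK wK vV zw.
have := CP1 [:: k; k] z w v tau isT zK wK vV zw.
rewrite big_cons /= -/S2; set A' := G [::] (w + _); set B := G [::] w; set D := G [::] z.
set S := \sum_(_ <- _) _; set Bk := G [:: k] w; set Dk := G [:: k] z.
set Bkk := G [:: k; k] w; set Dkk := G [:: k; k] z => h1 h2 h3 h4.
(* The first and last summands are the remainders up to the corner and along the last leg. The
   middle ones move the first and second derivatives in direction [k] from [w] back to [z]. *)
have -> : A' - D - tau * (v k * Dk + S)
      - tau ^+ 2 * (A + v k * S2 + v k ^+ 2 / 2 * Dkk)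
  = (B - D - tau * S - tau ^+ 2 * A)
  + v k * (tau * (Bk - Dk - tau * S2))
  + v k ^+ 2 / 2 * (tau ^+ 2 * (Bkk - Dkk))
  + (A' - B - Bk * (tau * v k) - Bkk / 2 * (tau * v k) ^+ 2) by field.
apply: (@le_trans _ _ ((C + E1) * `|tau| ^+ 3)); last first.
  by rewrite ler_wpM2r ?exprn_ge0// lerDl.
have -> : C + E1 = C + V * C2 + V ^+ 2 * C1 + M * V ^+ 3 by rewrite /E1; ring.
apply: (le_trans (ler_normD _ _)); rewrite mulrDl lerD//.
  apply: (le_trans (ler_normD _ _)); rewrite mulrDl lerD//.
    apply: (le_trans (ler_normD _ _)); rewrite mulrDl lerD// normrM -mulrA.
    by apply: ler_pM => //; rewrite normrM exprS mulrCA ler_wpM2l.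
  rewrite normrM -[leRHS]mulrA; apply: ler_pM => //.
    by rewrite normrM [`|2^-1|]ger0_norm// (le_trans _ V2)// ler_piMr//; lra.
  by rewrite normrM normrX (exprSr _ 2) mulrCA ler_wpM2l ?exprn_ge0.
apply: (le_trans h4); rewrite -mulrA ler_wpM2l// -exprMn lerXn2r ?nnegrE ?mulr_ge0//.
by rewrite normrM mulrC ler_wpM2r.
Qed.

End JetTaylor.

(** * Interpolation error *)

Section Interpolation1D.
Context {R : realType}.
Implicit Types (x s t delta M : R) (p m l n N : nat).

(** The basis function in the scaled distance from its node; [b] is the parity of the node. For p =
    2, odd nodes are midpoints of elements and even nodes are their ends. *)
Definition hat p (b : bool) x : R :=
  if p == 1%N then if `|x| <= 1 then 1 - `|x| else 0
  else if b then if `|x| <= 1 then 1 - x ^+ 2 else 0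
  else if `|x| <= 2 then (1 - `|x|) * (1 - `|x| / 2) else 0.

Lemma etapE p m s delta : 0 < delta ->
  etap p m%:Z s delta = hat p (odd m) (s / delta - m%:R).
Proof.
move=> d0; pose x := s / delta; pose y : R := m%:R.
have le1 c : (c * delta <= s) = (c <= x) by rewrite ler_pdivlMr.
have le2 c : (s <= c * delta) = (x <= c) by rewrite ler_pdivrMr.
have lt2 c : (s < c * delta) = (x < c) by rewrite ltr_pdivrMr.
have e2 : s / (2 * delta) = x / 2 by rewrite /x; field; lra.
have c0 : (m%:Z%:~R : R) = y by [].
have cp1 : ((m%:Z + 1)%:~R : R) = y + 1 by rewrite intrD.
have cp2 : ((m%:Z + 2)%:~R : R) = y + 2 by rewrite intrD.
have cm1 : ((m%:Z - 1)%:~R : R) = y - 1 by rewrite intrB.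
have cm2 : ((m%:Z - 2)%:~R : R) = y - 2 by rewrite intrB.
rewrite /etap /hat -/x -/y; case: ifP => _; [rewrite /eta1|rewrite /eta2];
  rewrite /= !le1 !le2 !lt2 ?e2 ?cp1 ?cp2 ?cm1 ?cm2 c0 -/x; last case: ifP => _;
  by case: (ger0P (x - y)) => xy; repeat (case: ifP => ?); try lra; nra.
Qed.

Lemma hat_supp p b x : hat p b x != 0 -> `|x| <= 2.
Proof.
rewrite /hat; case: ifP => _; [|case: b]; case: ifP; rewrite ?eqxx//; lra.
Qed.

Lemma hat_le1 p b x : `|hat p b x| <= 1.
Proof.
rewrite /hat -(real_normK (num_real x)).
have := normr_ge0 x; move: `|x| => t t0.
case: ifP => _; [|case: b]; case: ifP => t1; rewrite ?normr0// ler_norml; nra.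
Qed.

(** The same node, an adjacent one, or one at distance at least 2: each case gives its own lower
    bound for the distance to node [l] in [hat_dist]. *)
Lemma nat_dist3 m l : [\/ l = m, 
  (l%:R : R) = m%:R + 1 \/ (l%:R : R) = m%:R - 1 | (2 <= `|l%:R - m%:R| :> R)].
Proof.
have [ml|ml|->] := ltngtP m l; last by constructor.
- have [ml1|ml1|<-] := ltngtP m.+1 l; [|lia|by constructor 2; left; rewrite natr1].
  constructor 3; rewrite ger0_norm ?subr_ge0 ?ler_nat ?(ltnW ml)// lerBrDl.
  by rewrite -natrD ler_nat; lia.
- have [ml1|ml1|<-] := ltngtP l.+1 m; [|lia|by constructor 2; right; rewrite -natr1 addrK].
  constructor 3; rewrite distrC ger0_norm ?subr_ge0 ?ler_nat ?(ltnW ml)// lerBrDl.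
  by rewrite -natrD ler_nat; lia.
Qed.

(* Up to scaling, every basis function times the distance to its own node is
   the nodal polynomial of the element, which vanishes at all other nodes. *)
Lemma hat_dist p m l x :
  `|hat p (odd m) (x - m%:R)| * `|x - m%:R| <= 2 * `|x - l%:R|.
Proof.
have [->|ml|ml] := nat_dist3 m l.
- by rewrite ler_pM// (le_trans (hat_le1 _ _ _))// ler1n.
- have d1 : 1 - `|x - m%:R| <= `|x - l%:R| /\ `|x - m%:R| - 1 <= `|x - l%:R|.
    case: ml => ->; move: (m%:R : R) => y;
      by do 2 (case: (ger0P (x - y)) => ?); case: ger0P => ?; lra.
  case: d1; rewrite /hat -(real_normK (num_real (x - m%:R))).
  have := normr_ge0 (x - m%:R); move: `|x - m%:R| => t; move: `|x - l%:R| => t' t0 t1 t2.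
  case: ifP => _; [|case: (odd m)]; case: ifP => tle; rewrite ?normr0 ?mul0r.
  + rewrite ger0_norm; last by lra.
    by have := mulr_ge0 t0 (_ : 0 <= 1 - t); nra.
  + by lra.
  + rewrite ger0_norm; last by nra.
    by have := mulr_ge0 t0 (_ : 0 <= 1 - t); nra.
  + by lra.
  + rewrite normrM [`|1 - t / 2|]ger0_norm; last by lra.
    have : `|1 - t| <= t' by rewrite ler_norml; lra.
    have := normr_ge0 (1 - t); move: `|1 - t| => r; nra.
  + by lra.
- have d2 : 2 - `|x - m%:R| <= `|x - l%:R|.
    have := ler_distD x l%:R (m%:R : R); rewrite [`|l%:R - x|]distrC; lra.
  case: (eqVneq (hat p (odd m) (x - m%:R)) 0) => [->|/hat_supp].
    by rewrite normr0 mul0r mulr_ge0.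
  move: d2; rewrite /hat -(real_normK (num_real (x - m%:R))).
  have := normr_ge0 (x - m%:R); move: `|x - m%:R| => t; move: `|x - l%:R| => t' t0 d2 t2.
  case: ifP => _; [|case: (odd m)]; case: ifP => tle; rewrite ?normr0 ?mul0r.
  + rewrite ger0_norm; last by lra.
    by have := mulr_ge0 t0 (_ : 0 <= 1 - t); nra.
  + by lra.
  + rewrite ger0_norm; last by nra.
    by have t3 := mulr_ge0 t0 (sqr_ge0 t); nra.
  + by lra.
  + rewrite normrM [`|1 - t / 2|]ger0_norm; last by lra.
    have r1 : `|1 - t| <= 1 by rewrite ler_norml; lra.
    have t2' : 0 <= 1 - t / 2 by lra.
    have := ler_wpM2r (mulr_ge0 t2' t0) r1; have := mulr_ge0 t2' t2'; nra.
  + by lra.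
Qed.

Lemma sum_supp n x K (F : nat -> R) : 0 <= K ->
  (forall m, (m < n)%N -> F m != 0 -> `|x - m%:R| <= 2) ->
  (forall m, (m < n)%N -> `|F m| <= K) ->
  \sum_(m < n) `|F m| <= 5 * K.
Proof.
(* A closed interval of length 4 contains at most five integers. [Num.truncn] is 0 at numbers below
   1, negative ones included, so near the left end the window starts at node 0. *)
move=> K0 Fs FK; pose q := Num.truncn (x - 2).
have qP m : (m < n)%N -> F m != 0 -> m \in iota q 5.
  move=> mn /(Fs m mn); rewrite ler_norml => /andP[xm1 xm2]; rewrite mem_iota.
  apply/andP; split.
    have [x2|x2] := leP 1 (x - 2).
      rewrite -(ler_nat R); apply: (@le_trans _ _ (x - 2)); last by lra.
      by rewrite truncn_le; lra.
    by rewrite /q (_ : Num.truncn _ = 0%N)//; apply/truncn0Pn; rewrite -ltNge.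
  have : x - 2 < q.+1%:R := truncnS_gt _.
  rewrite -(ltr_nat R) natrD -natr1; lra.
apply: (@le_trans _ _ (\sum_(m < n | (m : nat) \in iota q 5) K)).
  rewrite [leRHS]big_mkcond /=; apply: ler_sum => m _.
  case: ifP => [_|/negP mq]; first exact: FK.
  have [->|/(qP _ (ltn_ord m))//] := eqVneq (F m) 0.
  by rewrite normr0.
rewrite sumr_const -[K *+ _]mulr_natl ler_wpM2r// ler_nat.
rewrite cardE -(size_map val) -[5%N](size_iota q); apply: uniq_leq_size.
  by rewrite map_inj_uniq ?enum_uniq//; exact: val_inj.
by move=> m /mapP[i]; rewrite mem_enum => + ->.
Qed.

Lemma sum_ord_sub n (F : nat -> R) (r : seq nat) :
  uniq r -> {in r, forall m, (m < n)%N} -> (forall m, (m < n)%N -> m \notin r -> F m = 0) ->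
  \sum_(m < n) F m = \sum_(m <- r) F m.
Proof.
move=> ur rn F0; rewrite -(big_mkord xpredT F) (bigID (mem r)) /= addrC big1_seq ?add0r.
  rewrite -big_filter; apply: perm_big; apply: uniq_perm => //.
    by rewrite filter_uniq ?iota_uniq.
  move=> m; rewrite mem_filter mem_index_iota /=.
  by case: (boolP (m \in r)) => //= /rn.
by move=> m /andP[mr]; rewrite mem_index_iota => /andP[_ mn]; exact: F0.
Qed.

(** Only the nodes of the element containing [x] contribute, which leaves the Lagrange formula on
    that element. *)
Lemma cell_sum1 N x (q : nat -> R) : (0 < N)%N -> 0 <= x <= N%:R ->
  exists j : nat, \sum_(m < N.+1) hat 1 (odd m) (x - m%:R) * q m
    = q j * (j%:R + 1 - x) + q j.+1 * (x - j%:R).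
Proof.
move=> N0 /andP[x0 xN].
have [j jN /andP[jx xj]] : exists2 j, (j.+1 <= N)%N & j%:R <= x <= j%:R + 1.
  (* At the right end [x = N] the integer part would name an element beyond the mesh, so the last
     element is taken. *)
  move: xN; rewrite le_eqVlt => /predU1P[->|xN].
    exists N.-1; first by rewrite prednK.
    by rewrite ler_nat leq_pred natr1 prednK// lexx.
  exists (Num.truncn x); first by rewrite -(ltr_nat R) (le_lt_trans _ xN)// truncn_le.
  by rewrite truncn_le x0 natr1 ltW// truncnS_gt.
exists j; rewrite (@sum_ord_sub _ (fun m => hat 1 (odd m) (x - m%:R) * q m) [:: j; j.+1]).
- rewrite !big_cons big_nil /= addr0 /hat /= -natr1.
  rewrite ger0_norm ?subr_ge0// ler0_norm; last by lra.
  by do 2 (case: ifP => ?); nra.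
- by rewrite /= inE; lia.
- by move=> m; rewrite !inE => /orP[]/eqP->; lia.
- move=> m mN; rewrite !inE => mj.
  suff -> : hat 1 (odd m) (x - m%:R) = 0 by rewrite mul0r.
  rewrite /hat /=; have [mj'|mj'] : ((m.+1 <= j) \/ (j.+2 <= m))%N by lia.
    move: mj'; rewrite -(ler_nat R) -natr1 => mj'.
    by rewrite ger0_norm ?subr_ge0; [case: ifP => ?; lra|lra].
  move: mj'; rewrite -(ler_nat R) -!natr1 => mj'.
  by rewrite ler0_norm; [case: ifP => ?; lra|lra].
Qed.

Lemma cell_sum2 N x (q : nat -> R) : (0 < N)%N -> ~~ odd N -> 0 <= x <= N%:R ->
  exists j : nat, \sum_(m < N.+1) hat 2 (odd m) (x - m%:R) * q m
    = q j * ((j%:R + 1 - x) * (j%:R + 2 - x) / 2)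
      + q j.+1 * ((x - j%:R) * (j%:R + 2 - x))
      + q j.+2 * ((x - j%:R) * (x - j%:R - 1) / 2).
Proof.
move=> N0 Ne /andP[x0 xN].
(* Quadratic elements span two mesh intervals and start at even nodes: twice the integer part of
   [x / 2], or [N - 2] at the right end. Evenness of [N] makes the element fit. *)
have [j [jN jo /andP[jx xj]]] : exists j, [/\ (j.+2 <= N)%N, ~~ odd j & j%:R <= x <= j%:R + 2].
  move: xN; rewrite le_eqVlt => /predU1P[->|xN].
    exists N.-2; split; [lia|lia|].
    by rewrite ler_nat; apply/andP; split; [lia|rewrite -natrD ler_nat; lia].
  have x20 : 0 <= x / 2 by lra.
  have [j j1 j2] : exists2 j : nat, j%:R <= x / 2 & x / 2 < j%:R + 1.
    by exists (Num.truncn (x / 2)); rewrite ?truncn_le// natr1 truncnS_gt.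
  exists j.*2; split; [|by rewrite odd_double|rewrite -mul2n natrM; apply/andP; split; lra].
  have : (j.*2 < N)%N by rewrite -(ltr_nat R) -mul2n natrM; lra.
  by lia.
exists j; rewrite (@sum_ord_sub _ (fun m => hat 2 (odd m) (x - m%:R) * q m) [:: j; j.+1; j.+2]).
- have s1 : j.+1%:R = j%:R + 1 :> R by rewrite natr1.
  have s2 : j.+2%:R = j%:R + 2 :> R by rewrite -natrD addn2.
  rewrite !big_cons big_nil /= addr0 /hat /= negbK (negPf jo) /= s1 s2.
  rewrite (ger0_norm (_ : 0 <= x - j%:R)) ?subr_ge0//.
  rewrite (ler0_norm (_ : x - (j%:R + 2) <= 0)); last by lra.
  rewrite !ifT; [by field|lra|by rewrite ler_norml; apply/andP; split; lra|lra].
- by rewrite /= !inE; lia.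
- by move=> m; rewrite !inE => /or3P[]/eqP->; lia.
- move=> m mN; rewrite !inE => mj.
  suff -> : hat 2 (odd m) (x - m%:R) = 0 by rewrite mul0r.
  rewrite /hat /=; case: ifP => mo.
    have : 1 <= `|x - m%:R|.
      have [mj'|mj'] : ((m.+1 <= j) \/ (j + 3 <= m))%N by lia.
        by move: mj'; rewrite -(ler_nat R) -natr1 ler_normr => mj'; apply/orP; left; lra.
      by move: mj'; rewrite -(ler_nat R) natrD ler_normr => mj'; apply/orP; right; lra.
    rewrite -(real_normK (num_real (x - m%:R))); case: ifP => // t1 t2.
    by rewrite (_ : `|x - m%:R| = 1) ?expr1n ?subrr//; apply/eqP; rewrite eq_le t1.
  have : 2 <= `|x - m%:R|.
    have [mj'|mj'] : ((m + 2 <= j) \/ (j + 4 <= m))%N by lia.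
      by move: mj'; rewrite -(ler_nat R) natrD ler_normr => mj'; apply/orP; left; lra.
    by move: mj'; rewrite -(ler_nat R) natrD ler_normr => mj'; apply/orP; right; lra.
  case: ifP => // t1 t2; have -> : `|x - m%:R| = 2 by apply/eqP; rewrite eq_le t1.
  by field.
Qed.

Definition mesh_ok p N := (0 < N)%N /\ (p = 2%N -> ~~ odd N).

(** The polynomial is centred at [s], so that its value there is [c0]. The condition on [c2] lets
    one statement cover degrees 1 and 2. *)
Lemma etap_reproduces p N delta s (c0 c1 c2 : R) :
  p = 1%N \/ p = 2%N -> mesh_ok p N -> 0 < delta -> 0 <= s <= N%:R * delta ->
  (p = 1%N -> c2 = 0) ->
  \sum_(m < N.+1) etap p m%:Z s delta
    * (c0 + c1 * (m%:R * delta - s) + c2 * (m%:R * delta - s) ^+ 2) = c0.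
Proof.
move=> hp [N0 Ne] d0 /andP[s0 sN] c20; under eq_bigr do rewrite etapE//.
have : s = s / delta * delta by rewrite divfK// gt_eqF.
have : 0 <= s / delta <= N%:R.
  by rewrite divr_ge0 ?(ltW d0)//= ler_pdivrMr.
move: (s / delta) => x xN sE.
pose q m := c0 + c1 * (m%:R * delta - s) + c2 * (m%:R * delta - s) ^+ 2.
case: hp => pE; rewrite pE in Ne c20 *.
  have [j] := cell_sum1 q N0 xN; rewrite {1}/q => ->.
  by rewrite /q c20// sE -!natr1; ring.
have [j] := cell_sum2 q N0 (Ne erefl) xN; rewrite {1}/q => ->.
by rewrite /q sE -!natr1; field.
Qed.

Lemma etap_sum1 p N delta s :
  p = 1%N \/ p = 2%N -> mesh_ok p N -> 0 < delta -> 0 <= s <= N%:R * delta ->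
  \sum_(m < N.+1) etap p m%:Z s delta = 1.
Proof.
move=> hp Nok d0 sN; have := @etap_reproduces p N delta s 1 0 0 hp Nok d0 sN (fun _ => erefl).
by under eq_bigr do rewrite !mul0r !addr0 mulr1.
Qed.

(** At most five terms are nonzero, each at most 1. The bound holds for every real [s], hence also
    for upwind points outside the domain. *)
Lemma etap_lebesgue p N delta s : 0 < delta ->
  \sum_(m < N.+1) `|etap p m%:Z s delta| <= 5.
Proof.
move=> d0; rewrite -[5]mulr1.
apply: (@sum_supp _ (s / delta) 1 (fun m => etap p m%:Z s delta)) => // m _.
  by rewrite etapE//; exact: hat_supp.
by rewrite etapE//; exact: hat_le1.
Qed.

(** Reproduction cancels the Taylor polynomial. In each remainder one of the p + 1 factors |m delta
    - s| is traded by [hat_dist] for 2 |s - l delta|; the others are at most 2 delta on the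
    support. *)
Lemma etap_error p N delta s (g : nat -> R) (g0 c1 c2 M : R) l :
  p = 1%N \/ p = 2%N -> mesh_ok p N -> 0 < delta -> 0 <= s <= N%:R * delta ->
  (p = 1%N -> c2 = 0) -> 0 <= M ->
  (forall m, (m <= N)%N ->
    `|g m - g0 - c1 * (m%:R * delta - s) - c2 * (m%:R * delta - s) ^+ 2|
      <= M * `|m%:R * delta - s| ^+ p.+1) ->
  `|g0 - \sum_(m < N.+1) etap p m%:Z s delta * g m|
    <= 40 * M * delta ^+ p * `|s - l%:R * delta|.
Proof.
move=> hp Nok d0 sN c20 M0 gT.
rewrite -[X in `|X - _|](etap_reproduces g0 c1 hp Nok d0 sN c20) -sumrB.
pose F m := etap p m%:Z s delta * (g m - g0 - c1 * (m%:R * delta - s)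
                                  - c2 * (m%:R * delta - s) ^+ 2).
under eq_bigr => m _ do rewrite -mulrBr.
apply: (@le_trans _ _ (\sum_(m < N.+1) `|F m|)).
  apply: (le_trans (ler_norm_sum _ _ _)); apply: ler_sum => m _.
  by rewrite -[leLHS]normrN /F le_eqVlt; apply/orP; left; apply/eqP; congr (`|_|); ring.
have sd m : s - m%:R * delta = delta * (s / delta - m%:R).
  by rewrite mulrBr mulrCA divff ?gt_eqF// mulr1 [_ * m%:R]mulrC.
have nd m : `|s - m%:R * delta| = delta * `|s / delta - m%:R|.
  by rewrite sd normrM gtr0_norm.
(* 40 = 5 * 4 * 2: five terms, a factor 2^p <= 4 from the support, and 2 from [hat_dist]. *)
have -> : 40 * M * delta ^+ p * `|s - l%:R * delta|
    = 5 * (8 * M * delta ^+ p * `|s - l%:R * delta|) by ring.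
apply: (@sum_supp _ (s / delta)).
- by rewrite !mulr_ge0// exprn_ge0// ltW.
- move=> m _; rewrite /F mulf_eq0 negb_or => /andP[+ _].
  by rewrite etapE//; exact: hat_supp.
move=> m mN; rewrite /F normrM etapE//.
have [->|hm] := eqVneq (hat p (odd m) (s / delta - m%:R)) 0.
  by rewrite normr0 mul0r !mulr_ge0// exprn_ge0// ltW.
have x2 := hat_supp hm; have hd := hat_dist p m l (s / delta).
apply: (le_trans (ler_wpM2l (normr_ge0 _) (gT m mN))).
rewrite distrC !nd; move: x2 hd; move: (`|s / delta - m%:R|) (normr_ge0 (s / delta - m%:R)) => t t0.
move: (`|s / delta - l%:R|) => t' x2 hd.
have tp : t ^+ p <= 4.
  have h2 : t ^+ 2 <= 2 ^+ 2 by rewrite lerXn2r ?nnegrE.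
  by case: hp => ->; [rewrite expr1; lra|rewrite (le_trans h2)//; lra].
have -> : `|hat p (odd m) (s / delta - m%:R)| * (M * (delta * t) ^+ p.+1)
  = M * delta ^+ p.+1 * (t ^+ p * (`|hat p (odd m) (s / delta - m%:R)| * t)).
  by rewrite exprMn (exprSr t); ring.
have -> : 8 * M * delta ^+ p * (delta * t') = M * delta ^+ p.+1 * (4 * (2 * t')).
  by rewrite exprSr; ring.
apply: ler_wpM2l; first by rewrite mulr_ge0// exprn_ge0// ltW.
by apply: ler_pM => //; [exact: exprn_ge0|exact: mulr_ge0].
Qed.

End Interpolation1D.

(** * Tensor-product interpolation in several variables *)

Section Interpolation.
Context {R : realType} {d : nat} (p : nat) (a : 'I_d -> R) (N : 'I_d -> nat).
Hypotheses (ha : forall k, 0 < a k) (hN : forall k, mesh_ok p (N k)).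
Implicit Types (x y z : 'rV[R]_d) (F : 'rV[R]_d -> R) (i : mesh_idx N).

Definition interp_weight y i : R :=
  \prod_k etap p (i k)%:Z (y 0 k) (mesh_size a N k).

Definition interp_scalar F y : R :=
  \sum_(i : mesh_idx N) interp_weight y i * F (lattice_pt a i).

Lemma interpE r c (v : 'rV[R]_d -> 'M[R]_(r, c)) y (i : 'I_r) (j : 'I_c) :
  interp p a N v y i j = interp_scalar (fun x => v x i j) y.
Proof. by rewrite /interp summxE; apply: eq_bigr => k _; rewrite mxE. Qed.

Lemma mesh_size_gt0 k : 0 < mesh_size a N k.
Proof. by rewrite divr_gt0// ltr0n; case: (hN k). Qed.

Lemma mesh_size_hmax k : mesh_size a N k <= hmax a N.
Proof. exact: le_bigmax. Qed.

Lemma mesh_sizeE k : (N k)%:R * mesh_size a N k = a k.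
Proof. by rewrite mulrC divfK// pnatr_eq0 -lt0n; case: (hN k). Qed.

Lemma interp_weight_sum y : \sum_i `|interp_weight y i| <= 5 ^+ d.
Proof.
under eq_bigr do rewrite normr_prod.
rewrite (sum_prod_dffun (fun k (m : 'I_(N k).+1) =>
  `|etap p m%:Z (y 0 k) (mesh_size a N k)|)).
rewrite (@le_trans _ _ (\prod_(k < d) 5))//; last by rewrite prodr_const card_ord.
apply: ler_prod => k _; rewrite sumr_ge0//=.
exact/etap_lebesgue/mesh_size_gt0.
Qed.

Lemma interp_weighted_bound y (Phi : mesh_idx N -> R) K :
  (forall i, `|Phi i| <= K) ->
  `|\sum_i interp_weight y i * Phi i| <= 5 ^+ d * K.
Proof.
move=> PK; apply: (le_trans (ler_norm_sum _ _ _)).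
(* The mesh has at least one index, so [K] dominates an absolute value and is nonnegative. *)
have [i0 _|i0] := pickP (fun _ : mesh_idx N => true); last first.
  have : mesh_idx N by exact: (finfun (fun k => ord0)).
  by move=> i; have := i0 i.
have K0 : 0 <= K := le_trans (normr_ge0 _) (PK i0).
apply: (@le_trans _ _ ((\sum_i `|interp_weight y i|) * K)); last first.
  by rewrite ler_wpM2r// interp_weight_sum.
by rewrite mulr_suml; apply: ler_sum => i _; rewrite normrM ler_wpM2l.
Qed.

Definition in_box y := forall k, 0 <= y 0 k <= a k.

Lemma lattice_in_box i : in_box (lattice_pt a i).
Proof.
move=> k; rewrite mxE mulr_ge0 ?(ltW (mesh_size_gt0 k))//=.
by rewrite -(mesh_sizeE k) ler_wpM2r ?(ltW (mesh_size_gt0 k))// ler_nat -ltnS.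
Qed.

(** These points lead from [y] (n = 0) to the lattice point (n = d), replacing one coordinate at a
    time. *)
Definition hybrid y n i : 'rV[R]_d :=
  \row_k if (k < n)%N then (i k)%:R * mesh_size a N k else y 0 k.

Lemma hybrid_in_box y n i : in_box y -> in_box (hybrid y n i).
Proof.
move=> yB k; rewrite mxE; case: ifP => _ //.
by have := lattice_in_box i k; rewrite mxE.
Qed.

(** The weighted sums of [F] over hybrid points telescope from [F y] to the interpolant. Each
    difference is an average of one-dimensional errors, and [5 ^+ d] bounds the total absolute
    weight. *)
Lemma interp_error F y x M : p = 1%N \/ p = 2%N -> 0 <= M ->
  (forall k z, in_box z -> exists c1 c2, (p = 1%N -> c2 = 0) /\
    forall z', in_box z' -> (forall l, l != k -> z' 0 l = z 0 l) ->
      `|F z' - F z - c1 * (z' 0 k - z 0 k) - c2 * (z' 0 k - z 0 k) ^+ 2|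
        <= M * `|z' 0 k - z 0 k| ^+ p.+1) ->
  in_box y -> Omega_h a N x ->
  `|F y - interp_scalar F y|
    <= 5 ^+ d * (40 * M * hmax a N ^+ p * \sum_k `|y 0 k - x 0 k|).
Proof.
move=> hp M0 FT yB [l _ xl].
pose E n := \sum_i interp_weight y i * F (hybrid y n i).
have w1 k : \sum_(m < (N k).+1) etap p m%:Z (y 0 k) (mesh_size a N k) = 1.
  by apply: etap_sum1 => //; [exact: mesh_size_gt0|rewrite mesh_sizeE; exact: yB].
have E0 : F y = E 0%N.
  rewrite /E (eq_bigr (fun i => interp_weight y i * F y)) => [|i _]; last first.
    by congr (_ * F _); apply/rowP => k; rewrite mxE.
  rewrite -mulr_suml [X in X * _](_ : _ = 1) ?mul1r//.
  rewrite (sum_prod_dffun (fun k (m : 'I_(N k).+1) =>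
    etap p m%:Z (y 0 k) (mesh_size a N k))).
  by rewrite big1 => // k _; exact: w1.
have Ed : interp_scalar F y = E d.
  apply: eq_bigr => i _; congr (_ * F _); apply/rowP => k.
  by rewrite !mxE ltn_ord.
rewrite E0 Ed distrC -telescope_sumr// big_mkord.
apply: (le_trans (ler_norm_sum _ _ _)).
rewrite mulr_sumr mulr_sumr; apply: ler_sum => k _.
rewrite distrC -sumrB; under eq_bigr do rewrite -mulrBr.
(* The index in direction [k] is averaged first: [hybrid y k] ignores it, while [hybrid y k.+1] runs
   through the nodes on a line, so the inner sum is a one-dimensional interpolation error. *)
rewrite (@dffun_average _ _ _ (fun k (m : 'I_(N k).+1) =>
    etap p m%:Z (y 0 k) (mesh_size a N k)) k (fun i =>
  F (hybrid y k i) - F (hybrid y k.+1 i)) (w1 k)).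
apply: interp_weighted_bound => i.
set z := hybrid y k i; have zB : in_box z by exact: hybrid_in_box.
have zk : z 0 k = y 0 k by rewrite mxE ltnn.
pose zz m : 'rV[R]_d := \row_l if l == k then m%:R * mesh_size a N k else z 0 l.
have zzE (m : 'I_(N k).+1) : hybrid y k.+1 (dffun_upd i m) = zz m.
  apply/rowP => j; rewrite !mxE; have [->|jk] := eqVneq j k.
    by rewrite leqnn dffun_upd_in.
  by rewrite dffun_upd_out// ltnS leq_eqVlt (inj_eq val_inj) (negPf jk).
have zE (m : 'I_(N k).+1) : hybrid y k (dffun_upd i m) = z.
  apply/rowP => j; rewrite !mxE; case: ifP => // jk.
  by rewrite dffun_upd_out//; apply: contraTneq jk => ->; rewrite ltnn.
under eq_bigr do rewrite zzE zE mulrBr.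
rewrite sumrB -mulr_suml w1 mul1r.
have [c1 [c2 [c20 cP]]] := FT k z zB.
have := @etap_error _ p (N k) (mesh_size a N k) (y 0 k) (fun m => F (zz m)) (F z)
  c1 c2 M (l k) hp (hN k) (mesh_size_gt0 k) _ c20 M0.
rewrite mesh_sizeE => /(_ (yB k)) H.
apply: le_trans (H _) _.
  move=> m mN; have := cP (zz m); rewrite zk mxE eqxx; apply.
    move=> j; rewrite mxE; case: eqP => [->|_]; last exact: zB.
    rewrite mulr_ge0 ?(ltW (mesh_size_gt0 k))//= -(mesh_sizeE k).
    by rewrite ler_wpM2r ?ler_nat// ltW// mesh_size_gt0.
  by move=> j jk; rewrite mxE (negPf jk).
rewrite -xl mxE ler_wpM2r// ler_wpM2l ?mulr_ge0//.
by rewrite lerXn2r ?nnegrE ?(ltW (mesh_size_gt0 k))// ?mesh_size_hmax//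
  (le_trans (ltW (mesh_size_gt0 k)))// mesh_size_hmax.
Qed.

End Interpolation.

(** * Consistency of the scheme *)

Section Consistency.
Context {R : realType} {d : nat} (p : nat) (a : 'I_d -> R) (T : R).
Hypotheses (ha : forall k, 0 < a k) (hT : 0 < T) (hp : p = 1%N \/ p = 2%N).
Local Notation pt := ('rV[R]_d * R)%type.
Local Notation dirs := (option 'I_d).
Implicit Types (x y : 'rV[R]_d) (z : pt) (N : 'I_d -> nat).

Lemma ccyl_pair x t : ccyl a T (x, t) <-> in_box a x /\ 0 <= t <= T.
Proof.
split=> [/(ccylE ha hT) K|[xB tT]]; first by split; [move=> j; exact: (K (Some j))|exact: (K None)].
by apply/(ccylE ha hT) => -[j|]; [exact: xB|].
Qed.

Lemma slide_coord x y t (k : 'I_d) : (forall l, l != k -> y 0 l = x 0 l) ->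
  (y, t) = (x, t) + (y 0 k - x 0 k) *: dir (Some k) :> pt.
Proof.
move=> xy; apply: coord_inj => l; rewrite coordD coordZ coord_dir.
case: l => [l|] /=; last by rewrite mulr0 addr0.
rewrite (inj_eq (@Some_inj _)); have [->|lk] := eqVneq l k; first by rewrite mulr1 addrC subrK.
by rewrite mulr0 addr0 xy.
Qed.

(** Along a coordinate line the jet supplies the polynomial required by [interp_error]: linear for p
    = 1, with half the second derivative added for p = 2. *)
Lemma jet_interp_error f G M N x y t :
  smooth_fun a T 3 f -> jet a T 3 f G M -> 0 <= M ->
  (forall k, mesh_ok p (N k)) -> in_box a y -> 0 <= t <= T -> Omega_h a N x ->
  `|f (y, t) - interp_scalar p a N (fun y => f (y, t)) y|
    <= 5 ^+ d * (40 * M * hmax a N ^+ p * \sum_k `|y 0 k - x 0 k|).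
Proof.
move=> fsm jG M0 hN yB tT xN; apply: interp_error => // k z zB.
have fE : G [::] = f by case: jG.
have zK : ccyl a T (z, t) by apply/ccyl_pair.
case: hp => ->.
  exists (G [:: Some k] (z, t)), 0; split=> // z' z'B zz'.
  have E := slide_coord t zz'; have z'K : ccyl a T (z', t) by apply/ccyl_pair.
  rewrite E in z'K; rewrite E -fE mul0r subr0.
  exact: (jet_line2 ha hT fsm jG zK z'K).
exists (G [:: Some k] (z, t)), (G [:: Some k; Some k] (z, t) / 2); split=> // z' z'B zz'.
have E := slide_coord t zz'; have z'K : ccyl a T (z', t) by apply/ccyl_pair.
rewrite E in z'K; rewrite E -fE.
exact: (jet_line3 ha hT fsm jG zK z'K).
Qed.

(** * The velocity field, its upwind points and the expansion along them *)

Variable u : pt -> 'rV[R]_d.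
Hypothesis u0 : forall x t, (closure (Omega a) `\` Omega a) x -> 0 <= t <= T ->
  u (x, t) = 0.
Variables (Gu : 'I_d -> seq dirs -> pt -> R) (Mu : R).
Hypotheses (Mu0 : 0 <= Mu)
  (usm : forall k, smooth_fun a T 3 (fun z => u z 0 k))
  (jGu : forall k, jet a T 3 (fun z => u z 0 k) (Gu k) Mu).

(** The first-order estimate between the point and its projection [y] onto the wall x_k = b, where
    the velocity vanishes. *)
Lemma velocity_near_wall x t k (b : R) : ccyl a T (x, t) -> b = 0 \/ b = a k ->
  `|u (x, t) 0 k| <= Mu * `|x 0 k - b|.
Proof.
move=> /[dup] xK /ccyl_pair[xB tT] bE.
pose y : 'rV[R]_d := \row_l if l == k then b else x 0 l.
have b0 : 0 <= b <= a k by case: bE => ->; rewrite lexx ltW.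
have yB : in_box a y.
  by move=> l; rewrite mxE; case: eqP => [->//|_]; exact: xB.
have yk : y 0 k = b by rewrite mxE eqxx.
have -> : u (x, t) 0 k = u (x, t) 0 k - u (y, t) 0 k.
  rewrite [u (y, t)]u0 ?mxE ?subr0//; split; first exact/(closure_OmegaE ha hT).
  by move=> /(_ k); rewrite yk; case: bE => ->; rewrite ltxx ?andbF.
have E : (x, t) = (y, t) + (x 0 k - y 0 k) *: dir (Some k) :> pt.
  by apply: slide_coord => l lk; rewrite mxE (negPf lk).
have yK : ccyl a T (y, t) by apply/ccyl_pair.
have uE : Gu k [::] = fun z => u z 0 k by case: (jGu k).
rewrite E in xK; rewrite -yk {1}E.
have := jet_line1 ha hT (usm k) (jGu k) yK xK (isT : (size [::] < 3)%N).
by rewrite uE.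
Qed.

(** In each direction the displacement is at most the distance to either wall, so no wall is
    crossed. *)
Lemma upwind_in_box x t (s : R) : ccyl a T (x, t) -> 0 <= s -> s * Mu <= 1 ->
  in_box a (x - s *: u (x, t)).
Proof.
move=> xK s0 sM k; have [xB _] := (ccyl_pair x t).1 xK.
have near b : b = 0 \/ b = a k -> s * `|u (x, t) 0 k| <= `|x 0 k - b|.
  move=> bE; apply: (le_trans (ler_wpM2l s0 (velocity_near_wall xK bE))).
  by rewrite mulrA -[leRHS]mul1r ler_wpM2r.
have := near 0 (or_introl erefl); have := near (a k) (or_intror erefl).
have /andP[x0 xa] := xB k.
rewrite !mxE subr0 [`|x 0 k - a k|]ler0_norm ?subr_le0// (ger0_norm x0).
rewrite -[s in s * _](ger0_norm s0) -normrM !ler_norml => /andP[? ?] /andP[? ?].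
by apply/andP; split; lra.
Qed.

Definition all_dirs : seq dirs := None :: map Some (enum 'I_d).

Lemma all_dirs_uniq : uniq all_dirs.
Proof.
rewrite /= map_inj_uniq ?enum_uniq ?andbT; last exact: Some_inj.
by apply/mapP => -[].
Qed.

Lemma mem_all_dirs k : k \in all_dirs.
Proof. by case: k => [j|]; rewrite // inE /= map_f// mem_enum. Qed.

(** The space-time velocity (-u, -1) of the characteristic followed backwards in time. *)
Definition upwind z (k : dirs) : R := if k is Some j then - u z 0 j else -1.

(** Applied to the jet of a function, this is minus its material derivative. *)
Definition upwind_derivative (G : seq dirs -> pt -> R) z : R :=
  \sum_(k <- all_dirs) upwind z k * G [:: k] z.

Lemma upwind_bound z k : ccyl a T z -> `|upwind z k| <= Mu + 1.
Proof.
move=> zK; case: k => [j|] /=; rewrite normrN ?normr1; last by rewrite lerDr.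
have := jet_bound (jGu j) (isT : (size [::] <= 3)%N) zK.
by case: (jGu j) => -> _ h; rewrite (le_trans h)// lerDl.
Qed.

Lemma upwind_derivative_bound f G M z : jet a T 3 f G M -> ccyl a T z ->
  `|upwind_derivative G z| <= (size all_dirs)%:R * ((Mu + 1) * M).
Proof.
move=> jG zK; rewrite /upwind_derivative; elim: all_dirs => [|k r IH].
  by rewrite big_nil normr0 mul0r.
rewrite big_cons /= -natr1 mulrDl mul1r addrC; apply: (le_trans (ler_normD _ _)).
by rewrite lerD// normrM; apply: ler_pM => //; [exact: upwind_bound|exact: (jet_bound jG)].
Qed.

(** [A] is common to both values of [m], and the error carries an extra factor [dt] to survive the
    division by [2 * dt] in the scheme. *)
Lemma characteristic_error f : smooth_fun a T 3 f ->
  forall G M, jet a T 3 f G M -> 0 <= M ->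
  exists2 C, 0 <= C & forall dt N x n, 0 < dt -> (forall k, mesh_ok p (N k)) ->
    Omega_h a N x -> (2 <= n <= Num.truncn (T / dt))%N ->
  let z := (x, tn dt n) in
  exists2 A, `|A| <= C & forall m, (m = 1 \/ m = 2)%N ->
    `|interp_scalar p a N (fun y => f (y, tn dt (n - m))) (x - (m%:R * dt) *: u z)
      - (f z + m%:R * dt * upwind_derivative G z + (m%:R * dt) ^+ 2 * A)|
    <= C * (dt ^+ 2 + hmax a N ^+ p) * dt.
Proof.
move=> fsm G M jG M0.
pose V := Mu + 1; have V0 : 0 <= V by rewrite addr_ge0.
have vV z k : ccyl a T z -> `|upwind z k| <= V by exact: upwind_bound.
have [C3 C30 C3P] := jet_taylor3 ha hT fsm jG M0 V0 all_dirs_uniq.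
pose S := (size all_dirs)%:R * (V * M).
have S0 : 0 <= S by rewrite !mulr_ge0.
have SP z : ccyl a T z -> `|upwind_derivative G z| <= S.
  exact: (upwind_derivative_bound jG).
(* [V] bounds the upwind velocity, so each coordinate of an upwind point differs from that of [x] by
   at most 2 V dt. *)
pose CI := 5 ^+ d * (40 * M * (d%:R * (2 * V))).
have CI0 : 0 <= CI by rewrite !mulr_ge0// exprn_ge0.
pose B := 5 ^+ d * M + (M + 2 * T * S + (2 * T) ^+ 2 * C3).
have B0 : 0 <= B by rewrite !addr_ge0 ?mulr_ge0 ?exprn_ge0 ?mulr_ge0// ltW.
(* The summands serve in turn for the coefficient [A], the Taylor remainder at s <= 2 dt (8 = 2^3),
   the interpolation error, and the regime 2 dt Mu > 1, where the crude bound [B] is at most B (2 dt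
   Mu)^3. *)
pose C := C3 + (8 * C3 + CI + B * (2 * Mu) ^+ 3).
have C0 : 0 <= C by rewrite !addr_ge0 ?mulr_ge0 ?exprn_ge0 ?mulr_ge0.
exists C => // dt N x n dt0 hN xN /andP[n2 nT] z.
have h0 : 0 <= hmax a N ^+ p by apply/exprn_ge0/bigmax_ge_id.
have ndt : n%:R * dt <= T.
  by rewrite -ler_pdivlMr// (le_trans _ (_ : (Num.truncn (T / dt))%:R <= _))
    ?ler_nat// truncn_le divr_ge0// ltW.
have xB : in_box a x by case: xN => i _ <-; exact: lattice_in_box.
have zK : ccyl a T z.
  by apply/ccyl_pair; split => //; rewrite /tn ndt mulr_ge0// ltW.
have [A AC AP] := C3P z (upwind z) zK (fun k => vV z k zK).
exists A; first by rewrite (le_trans AC)// lerDl !addr_ge0 ?mulr_ge0 ?exprn_ge0 ?mulr_ge0.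
move=> m m12; set s := m%:R * dt; set y := x - s *: u z.
have m2 : (m <= 2)%N by case: m12 => ->.
have s0 : 0 <= s by rewrite mulr_ge0// ltW.
have s2 : s <= 2 * dt by rewrite ler_wpM2r ?ler_nat// ltW.
have dtT : 2 * dt <= T.
  by apply: le_trans ndt; rewrite ler_wpM2r ?ler_nat// ltW.
have tE : tn dt (n - m) = tn dt n - s.
  by rewrite /tn /s natrB ?mulrBl// (leq_trans m2).
have tT : 0 <= tn dt (n - m) <= T.
  rewrite /tn mulr_ge0 ?(ltW dt0)//= (le_trans _ ndt)//.
  by rewrite ler_wpM2r ?ler_nat ?leq_subr// ltW.
have fE : G [::] = f by case: jG.
have fb w : ccyl a T w -> `|f w| <= M.
  by move=> wK; rewrite -fE; apply: (jet_bound jG).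
set I := interp_scalar _ _ _ _ _; set D := upwind_derivative _ _.
have d3 : 0 <= dt ^+ 2 * dt by rewrite mulr_ge0 ?exprn_ge0// ltW.
have hd : 0 <= hmax a N ^+ p * dt by rewrite mulr_ge0// ltW.
have [small|large] := leP (2 * dt * Mu) 1.
  have yB : in_box a y.
    by apply: upwind_in_box => //; apply: le_trans small; rewrite ler_wpM2r.
  have yK : ccyl a T (y, tn dt (n - m)) by apply/ccyl_pair.
  have e1 := jet_interp_error fsm jG M0 hN yB tT xN.
  have e2 : `|f (y, tn dt (n - m)) - f z - s * D - s ^+ 2 * A| <= C3 * s ^+ 3.
    rewrite -[X in X ^+ 3](ger0_norm s0); apply: AP => // l; rewrite mem_all_dirs.
    case: l => [l|] /=; first by rewrite !mxE mulrN.
    by rewrite tE mulrN1.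
  have yx : \sum_k `|y 0 k - x 0 k| <= d%:R * (2 * V) * dt.
    rewrite -mulrA -[d in d%:R]card_ord -sumr_const mulr_suml; apply: ler_sum => k _.
    rewrite mul1r !mxE addrAC subrr add0r normrN normrM (ger0_norm s0).
    have -> : 2 * V * dt = 2 * dt * V by ring.
    apply: ler_pM => //.
    by have := vV z (Some k) zK; rewrite /= normrN.
  have -> : I - (f z + s * D + s ^+ 2 * A) = - (f (y, tn dt (n - m)) - I)
     + (f (y, tn dt (n - m)) - f z - s * D - s ^+ 2 * A) by ring.
  apply: (le_trans (ler_normD _ _)); rewrite normrN.
  apply: (@le_trans _ _ (CI * (hmax a N ^+ p * dt) + 8 * C3 * (dt ^+ 2 * dt))).
    apply: lerD.
      apply: (le_trans e1).
      have -> : CI * (hmax a N ^+ p * dt) =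
        5 ^+ d * (40 * M * hmax a N ^+ p * (d%:R * (2 * V) * dt)) by rewrite /CI; ring.
      by rewrite ler_wpM2l ?exprn_ge0// ler_wpM2l// !mulr_ge0.
    apply: (le_trans e2); have -> : 8 * C3 * (dt ^+ 2 * dt) = C3 * (2 * dt) ^+ 3 by ring.
    by rewrite ler_wpM2l// lerXn2r ?nnegrE// mulr_ge0// ltW.
  have -> : C * (dt ^+ 2 + hmax a N ^+ p) * dt
    = C * (hmax a N ^+ p * dt) + C * (dt ^+ 2 * dt) by ring.
  apply: lerD; apply: ler_wpM2r => //.
    rewrite /C; have : 0 <= B * (2 * Mu) ^+ 3 by rewrite !mulr_ge0// exprn_ge0// mulr_ge0.
    by lra.
  rewrite /C; have : 0 <= B * (2 * Mu) ^+ 3 by rewrite !mulr_ge0// exprn_ge0// mulr_ge0.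
  by lra.
(* The upwind point may now lie outside the box; only lattice values and the sum of the absolute
   weights enter this bound. *)
have IB : `|I| <= 5 ^+ d * M.
  apply: interp_weighted_bound => // i; apply: fb; apply/ccyl_pair; split => //.
  exact: lattice_in_box.
apply: (@le_trans _ _ B).
  apply: (le_trans (ler_normB _ _)); apply: lerD => //.
  apply: (le_trans (ler_normD _ _)); apply: lerD.
    apply: (le_trans (ler_normD _ _)); apply: lerD; first exact: fb.
    rewrite normrM; apply: ler_pM => //; last exact: SP.
    by rewrite ger0_norm//; lra.
  rewrite normrM; apply: ler_pM => //.
  by rewrite ger0_norm ?exprn_ge0// lerXn2r ?nnegrE//; lra.
have -> : C * (dt ^+ 2 + hmax a N ^+ p) * dt = B * (2 * dt * Mu) ^+ 3
  + ((C3 + 8 * C3 + CI) * (dt ^+ 2 * dt) + C * (hmax a N ^+ p * dt)).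
  by rewrite /C; ring.
rewrite -[leLHS]addr0 lerD//; last first.
  apply: addr_ge0; apply: mulr_ge0 => //.
  by apply: addr_ge0 => //; rewrite addr_ge0// mulr_ge0.
by rewrite -[leLHS]mulr1 ler_wpM2l// exprn_ege1// ltW.
Qed.

End Consistency.

(** * The backward difference for scalar entries *)

(* [al], [be] are entries of the identity matrix and [g], [g'] of the velocity
   gradient; the difference quotient is exact on quadratic polynomials in time,
   so that only the terms of order 3 and 4 and the remainders survive. *)
Lemma bdf2_identity (R : realFieldType) (dt al be g g' Z0 D A F1 F2 : R) :
  dt != 0 ->
  al * be * (- D) - g * be * Z0 - al * g' * Z0
  - (2 * dt)^-1 * (3 * (al * be * Z0) - 4 * ((al + dt * g) * (be + dt * g') * F1)
       + (al + 2 * dt * g) * (be + 2 * dt * g') * F2)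
  = - (2 * ((g * be + al * g') * A + g * g' * D) + 6 * (g * g' * A) * dt) * dt ^+ 2
    + (4 * ((al + dt * g) * (be + dt * g')) * (F1 - (Z0 + dt * D + dt ^+ 2 * A))
      - (al + 2 * dt * g) * (be + 2 * dt * g')
        * (F2 - (Z0 + 2 * dt * D + (2 * dt) ^+ 2 * A))) / (2 * dt).
Proof. by move=> dt0; field. Qed.

(** [F1] and [F2] are the interpolated values at the two earlier times, and [e] stands for dt^2 +
    h^p. The factor [dt] in their errors absorbs the division by [2 * dt]; the 5 covers the weights
    4 and 1. *)
Lemma bdf2_bound (R : realFieldType) (dt T al be g g' Z0 D A F1 F2 B S e : R) :
  0 < dt -> dt <= T -> 0 <= B -> 0 <= S ->
  `|al| <= 1 -> `|be| <= 1 -> `|g| <= B -> `|g'| <= B -> `|D| <= S -> `|A| <= S ->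
  dt ^+ 2 <= e ->
  `|F1 - (Z0 + dt * D + dt ^+ 2 * A)| <= S * e * dt ->
  `|F2 - (Z0 + 2 * dt * D + (2 * dt) ^+ 2 * A)| <= S * e * dt ->
  `|al * be * (- D) - g * be * Z0 - al * g' * Z0
  - (2 * dt)^-1 * (3 * (al * be * Z0) - 4 * ((al + dt * g) * (be + dt * g') * F1)
       + (al + 2 * dt * g) * (be + 2 * dt * g') * F2)|
  <= (2 * (2 * B * S + B ^+ 2 * S) + 6 * (B ^+ 2 * S) * T
      + 5 * ((1 + 2 * T * B) ^+ 2 * S)) * e.
Proof.
move=> dt0 dtT B0 S0 hal hbe hg hg' hD hA he hF1 hF2; have dt0' := ltW dt0.
rewrite (bdf2_identity _ _ _ _ _ _ A) ?gt_eqF//.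
have T0 : 0 <= T by lra.
have e0 : 0 <= e by rewrite (le_trans _ he)// exprn_ge0// ltW.
have fac (r : R) b q : 0 <= r -> r <= 2 * T -> `|b| <= 1 -> `|q| <= B ->
    `|b + r * q| <= 1 + 2 * T * B.
  move=> r0 r2 hb hq; rewrite (le_trans (ler_normD _ _))// lerD// normrM ger0_norm//.
  by apply: ler_pM.
have L0 : 0 <= 1 + 2 * T * B by rewrite addr_ge0// !mulr_ge0.
have gg : `|g * g'| <= B ^+ 2 by rewrite normrM expr2; apply: ler_pM.
have q1 : `|g * be + al * g'| <= 2 * B.
  have -> : 2 * B = B * 1 + 1 * B by ring.
  by rewrite (le_trans (ler_normD _ _))// !normrM lerD//; apply: ler_pM.
rewrite [leRHS]mulrDl; apply: (le_trans (ler_normD _ _)); apply: lerD.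
  rewrite normrM normrN [`|dt ^+ 2|]ger0_norm ?exprn_ge0//.
  apply: ler_pM => //; first by rewrite exprn_ge0.
  apply: (le_trans (ler_normD _ _)); apply: lerD.
    rewrite normrM [`|2|]ger0_norm//; apply: ler_wpM2l => //.
    apply: (le_trans (ler_normD _ _)).
    by apply: lerD; rewrite normrM; apply: ler_pM.
  rewrite normrM [`|dt|]gtr0_norm//; apply: ler_pM => //.
  by rewrite normrM [`|6|]ger0_norm// ler_wpM2l// normrM; apply: ler_pM.
have term (w b c r F G : R) : 0 <= w -> 0 <= r -> r <= 2 * T -> `|b| <= 1 -> `|c| <= 1 ->
    `|F| <= S * e * dt -> `|w * ((b + r * g) * (c + r * g')) * F|
    <= w * ((1 + 2 * T * B) ^+ 2 * (S * e * dt)).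
  move=> w0 r0 r2 hb hc hF; rewrite !normrM (ger0_norm w0) -mulrA ler_wpM2l//.
  by rewrite -normrM ler_pM// normrM expr2; apply: ler_pM => //; exact: fac.
rewrite normrM [`|(2 * dt)^-1|]ger0_norm ?invr_ge0 ?mulr_ge0//.
rewrite ler_pdivrMr ?mulr_gt0//.
apply: (le_trans (ler_normB _ _)).
apply: (@le_trans _ _ (4 * ((1 + 2 * T * B) ^+ 2 * (S * e * dt))
                     + 1 * ((1 + 2 * T * B) ^+ 2 * (S * e * dt)))).
  apply: lerD; first by apply: term => //; lra.
  by rewrite -[X in `|X * _|]mul1r; apply: term => //; lra.
have : 0 <= (1 + 2 * T * B) ^+ 2 * (S * e * dt).
  by rewrite mulr_ge0 ?exprn_ge0// !mulr_ge0// ltW.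
set Q := (1 + 2 * T * B) ^+ 2; move=> Q0.
have -> : 5 * (Q * S) * e * (2 * dt) = 10 * (Q * (S * e * dt)) by ring.
lra.
Qed.

(** * From entries to the matrix estimate *)

Lemma enorm_le (R : realType) d (A : 'M[R]_d) K : 0 <= K ->
  (forall i j, `|A i j| <= K) -> enorm A <= d%:R * K.
Proof.
move=> K0 AK; rewrite /enorm -[leRHS]ger0_norm ?mulr_ge0// -sqrtr_sqr.
rewrite ler_sqrt ?sqr_ge0//.
apply: (@le_trans _ _ (\sum_(i < d) \sum_(j < d) K ^+ 2)).
  apply: ler_sum => i _; apply: ler_sum => j _.
  by rewrite -real_normK ?num_real// lerXn2r ?nnegrE.
by rewrite !sumr_const !card_ord -[leLHS]mulr_natl -[K ^+ 2 *+ d]mulr_natl exprMn mulrA -expr2.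
Qed.

(** Collecting by the entries of [Z] reduces the matrix error to scalar errors, one for each entry
    of the stress tensor. *)
Lemma mulmx_quad (R : comNzRingType) d (A B Z : 'M[R]_d) i j :
  (A *m Z *m B^T) i j = \sum_(q : 'I_d * 'I_d) A i q.1 * B j q.2 * Z q.1 q.2.
Proof.
rewrite mxE; under eq_bigr do rewrite mxE mxE mulr_suml.
rewrite exchange_big pair_bigA /=; apply: eq_bigr => -[k l] _ /=.
by rewrite mulrAC.
Qed.

Lemma jet_le (R : realType) d (a : 'I_d -> R) T m f G M M' :
  M <= M' -> jet a T m f G M -> jet a T m f G M'.
Proof.
move=> MM [f0 fj]; split => // s /fj[gc gb gE]; split => // z /gb h.
exact: le_trans MM.
Qed.

Theorem theorem2 (R : realType) (p d : nat) (hp : p = 1%N \/ p = 2%N)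
    (hd : d = 1%N \/ d = 2%N) (T : R) (hT : 0 < T)
    (a : 'I_d -> R) (ha : forall k, 0 < a k) :
  exists m : nat,
  forall (u : 'rV[R]_d * R -> 'rV[R]_d) (zeta : 'rV[R]_d * R -> 'M[R]_d)
    (h0 gamma1 gamma2 : R),
    smooth a T m u ->
    (forall x t, (closure (Omega a) `\` Omega a) x -> 0 <= t <= T ->
       u (x, t) = 0) ->
    smooth a T m zeta ->
    0 < h0 -> 0 < gamma1 -> 0 < gamma2 ->
  exists C : R, 0 < C /\
  forall (dt : R) (N : 'I_d -> nat) (x : 'rV[R]_d) (n : nat),
    0 < dt ->
    (dt%:E * C0W1inf a T u <= (1 / 8)%:E)%E ->
    (forall k, (0 < N k)%N) ->
    (p = 2%N -> forall k, ~~ odd (N k)) ->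
    hmax a N <= h0 ->
    gamma1 <= hmax a N / hmin a N <= gamma2 ->
    Omega_h a N x ->
    (2 <= n <= Num.truncn (T / dt))%N ->
    enorm (upper_convected a T u zeta (x, tn dt n) - Ah a T dt u p N n zeta x)
      <= C * (dt ^+ 2 + hmax a N ^+ p).
Proof.
(* Third derivatives enter the Taylor remainder along characteristics and the error of quadratic
   interpolation. *)
exists 3%N => u zeta h0 gamma1 gamma2 us u0 zs _ _ _.
have /choice[Ju JuP] k : exists GM : (seq (option 'I_d) -> 'rV[R]_d * R -> R) * R,
    jet a T 3 (fun z => u z 0 k) GM.1 GM.2.
  by have [G [M jG]] := smooth_jet ha hT (us 0 k); exists (G, M).
have /choice[Jz JzP] (q : 'I_d * 'I_d) :
    exists GM : (seq (option 'I_d) -> 'rV[R]_d * R -> R) * R,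
    0 <= GM.2 /\ jet a T 3 (fun z => zeta z q.1 q.2) GM.1 GM.2.
  have [G [M jG]] := smooth_jet ha hT (zs q.1 q.2); exists (G, `|M|) => /=.
  by split; [exact: normr_ge0 | exact: jet_le (ler_norm M) jG].
(* The sum is a single bound valid for the jets of all velocity components. *)
pose Mu := \sum_k `|(Ju k).2|; have Mu0 : 0 <= Mu by apply: sumr_ge0.
have jGu k : jet a T 3 (fun z => u z 0 k) (Ju k).1 Mu.
  apply: jet_le (JuP k); apply: (le_trans (ler_norm _)).
  by rewrite /Mu (bigD1 k)//= lerDl sumr_ge0.
have /choice[C CP] (q : 'I_d * 'I_d) : exists C, 0 <= C /\
    forall dt (N : 'I_d -> nat) x n, 0 < dt -> (forall k, mesh_ok p (N k)) ->
    Omega_h a N x -> (2 <= n <= Num.truncn (T / dt))%N ->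
    exists2 A, `|A| <= C & forall m, (m = 1 \/ m = 2)%N ->
    `|interp_scalar p a N (fun y => zeta (y, tn dt (n - m)) q.1 q.2)
        (x - (m%:R * dt) *: u (x, tn dt n))
      - (zeta (x, tn dt n) q.1 q.2
         + m%:R * dt * upwind_derivative u (Jz q).1 (x, tn dt n)
         + (m%:R * dt) ^+ 2 * A)|
    <= C * (dt ^+ 2 + hmax a N ^+ p) * dt.
  have [M0 jG] := JzP q.
  have [C C0 CP] := characteristic_error ha hT hp u0 Mu0 (us 0) jGu (zs q.1 q.2) jG M0.
  by exists C; split.
(* [bdf2_bound] takes one constant for the expansion error, the coefficient [A] and the upwind
   derivative; the sum dominates all three. *)
pose S q := C q + (size (@all_dirs d))%:R * ((Mu + 1) * (Jz q).2).
have S1 q : 0 <= (size (@all_dirs d))%:R * ((Mu + 1) * (Jz q).2).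
  by rewrite !mulr_ge0 ?addr_ge0//; have [] := JzP q.
have S0 q : 0 <= S q by rewrite addr_ge0//; case: (CP q).
pose K q := 2 * (2 * Mu * S q + Mu ^+ 2 * S q) + 6 * (Mu ^+ 2 * S q) * T
      + 5 * ((1 + 2 * T * Mu) ^+ 2 * S q).
have T0 := ltW hT.
have K0 q : 0 <= K q.
  rewrite /K; move: (S q) (S0 q) => s s0; have ? : 0 <= 2 * T * Mu by rewrite !mulr_ge0.
  by apply: addr_ge0; [apply: addr_ge0|];
    rewrite ?mulr_ge0 ?addr_ge0 ?mulr_ge0 ?exprn_ge0 ?addr_ge0.
(* The 1 ensures positivity; the factor [d] comes from bounding the Frobenius norm by the largest
   entry. *)
exists (1 + d%:R * \sum_q K q); split.
  by rewrite ltr_pwDl// mulr_ge0// sumr_ge0.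
move=> dt N x n dt0 _ N0 Ne _ _ xN nT.
have hN k : mesh_ok p (N k) by split => // /Ne.
pose e := dt ^+ 2 + hmax a N ^+ p.
have h0' : 0 <= hmax a N ^+ p by apply/exprn_ge0/bigmax_ge_id.
have e0 : 0 <= e by rewrite addr_ge0// exprn_ge0// ltW.
have [n2 nT'] := andP nT.
have ndt : n%:R * dt <= T.
  rewrite -ler_pdivlMr// (@le_trans _ _ (Num.truncn (T / dt))%:R) ?ler_nat//.
  by rewrite truncn_le divr_ge0// ltW.
have dtT : dt <= T.
  by apply: le_trans ndt; rewrite -[leLHS]mul1r ler_wpM2r ?(ltW dt0)// ler1n ltnW.
have xB : in_box a x by case: xN => i _ <-; exact: lattice_in_box.
pose z := (x, tn dt n).
have zK : ccyl a T z.
  by apply/(ccyl_pair ha hT); split => //; rewrite /tn ndt mulr_ge0// ltW.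
pose D q := upwind_derivative u (Jz q).1 z.
pose W : 'M[R]_d := \matrix_(k, l) - D (k, l).
have gradE i k : grad a T u z i k = (Ju i).1 [:: Some k] z.
  by rewrite mxE (jet_pderiv ha hT _ (isT : (0 < 3)%N) (jGu i) zK).
have WE : pderiv a T None zeta z + \sum_k u z 0 k *: pderiv a T (Some k) zeta z = W.
  apply/matrixP => i j; rewrite !mxE summxE /D /upwind_derivative.
  have jz := (JzP (i, j)).2.
  rewrite /all_dirs big_cons big_map big_enum /= mulN1r opprD opprK.
  rewrite -sumrN; congr (_ + _).
    by have := jet_pderiv ha hT None (isT : (0 < 3)%N) jz zK; rewrite mxE.
  apply: eq_bigr => k _; rewrite mxE mulNr opprK.
  by rewrite (jet_pderiv ha hT (Some k) (isT : (0 < 3)%N) jz zK).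
(* Identity factors give every term the shape A Z B^T, so that [mulmx_quad] applies to all of
   them. *)
have DE : upper_convected a T u zeta z = 1%:M *m W *m (1%:M)^T
    - grad a T u z *m zeta z *m (1%:M)^T - 1%:M *m zeta z *m (grad a T u z)^T.
  by rewrite /upper_convected WE trmx1 !mulmx1 !mul1mx.
have zE : zeta z = 1%:M *m zeta z *m (1%:M)^T by rewrite trmx1 mulmx1 mul1mx.
rewrite mulrDl mul1r; apply: (@le_trans _ _ (d%:R * ((\sum_q K q) * e))); last first.
  by rewrite -mulrA lerDr.
apply: enorm_le => [|i j]; first by rewrite mulr_ge0// sumr_ge0.
pose I m : 'M[R]_d := interp p a N (fun y => zeta (y, tn dt (n - m)))
  (x - (m%:R * dt) *: u z).
(* The contribution of the entry [q] of the stress tensor to the error at [(i, j)], in the form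
   bounded by [bdf2_bound]. *)
pose E q := 1%:M i q.1 * 1%:M j q.2 * (- D q)
  - grad a T u z i q.1 * 1%:M j q.2 * zeta z q.1 q.2
  - 1%:M i q.1 * grad a T u z j q.2 * zeta z q.1 q.2
  - (2 * dt)^-1 * (3 * (1%:M i q.1 * 1%:M j q.2 * zeta z q.1 q.2)
     - 4 * ((1%:M i q.1 + dt * grad a T u z i q.1)
            * (1%:M j q.2 + dt * grad a T u z j q.2) * I 1%N q.1 q.2)
     + (1%:M i q.1 + 2 * dt * grad a T u z i q.1)
            * (1%:M j q.2 + 2 * dt * grad a T u z j q.2) * I 2%N q.1 q.2).
have -> : (upper_convected a T u zeta (x, tn dt n) - Ah a T dt u p N n zeta x) i j
    = \sum_q E q.
  have I1 : interp p a N (fun y => zeta (y, tn dt (n - 1))) (X1 dt u n x) = I 1%N.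
    by rewrite /I mul1r.
  have addE (A B : 'M[R]_d) : (A + B) i j = A i j + B i j by rewrite mxE.
  have oppE (A : 'M[R]_d) : (- A) i j = - A i j by rewrite mxE.
  have scaleE (c : R) (A : 'M[R]_d) : (c *: A) i j = c * A i j by rewrite mxE.
  rewrite DE /Ah -/z I1 {3}zE -/(I 2%N) !(addE, oppE, scaleE) !mulmx_quad.
  rewrite !mulr_sumr -!sumrB -big_split mulr_sumr -sumrB /=.
  by apply: eq_bigr => -[k l] _; rewrite /E /L1 /tL1 !mxE.
apply: (le_trans (ler_norm_sum _ _ _)); rewrite mulr_suml; apply: ler_sum => q _.
have [Cq0 /(_ dt N x n dt0 hN xN nT)[A AC AP]] := CP q.
have CS : C q <= S q by rewrite lerDl.
have id1 k l : `|(1%:M : 'M[R]_d) k l| <= 1.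
  by rewrite mxE; case: (k == l); rewrite ?normr1 ?normr0 ?ler01.
have gM k l : `|grad a T u z k l| <= Mu.
  by rewrite gradE; exact: (jet_bound (jGu k)).
have F m : (m = 1 \/ m = 2)%N -> `|I m q.1 q.2 - (zeta z q.1 q.2
    + m%:R * dt * D q + (m%:R * dt) ^+ 2 * A)| <= S q * e * dt.
  move=> /AP h; rewrite interpE (le_trans h)// ler_wpM2r ?(ltW dt0)//.
  by rewrite ler_wpM2r.
apply: (@bdf2_bound _ dt T _ _ _ _ _ _ A) => //.
- apply: (le_trans (upwind_derivative_bound Mu0 jGu (JzP q).2 zK)).
  by rewrite lerDr.
- exact: le_trans CS.
- by rewrite lerDl.
- by have := F 1%N (or_introl erefl); rewrite mul1r.
- exact: (F 2%N (or_intror erefl)).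
Qed.
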